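(* Let $\mu$ be a finite symmetric nonnegative Borel measure on the unit sphere $\mathbb{S}^{d-1}$ of $\mathbb{R}^d$ such that $\mu\neq 0$. Then the Gaussian field $B_\mu=\{B_\mu(t),\,t\in\mathbb{R}^d\}$ is a homogeneous mono-Hölder field and, almost surely, for all $t\in\mathbb{R}^d$, $\alpha_{B_\mu}(t)=1/2$.
   Context: Let $d\ge 1$. A measure $\mu$ on $\mathbb{S}^{d-1}$ is symmetric if it is invariant under $s\mapsto -s$. Let $\mathbb{H}_d=(0,\infty)\times\mathbb{S}^{d-1}$, let $\mathcal{B}_0(\mathbb{H}_d)$ be the collection of relatively compact Borel subsets of $\mathbb{H}_d$ in the sense that their $\rho$-coordinates are bounded, and for $t\in\mathbb{R}^d$ let $V_t=\{(\rho,s)\in\mathbb{H}_d : \rho<\langle s,t\rangle\}$. Let $\{\mathfrak{B}_\mu(V),\,V\in\mathcal{B}_0(\mathbb{H}_d)\}$ be the centered Gaussian process with covariance $\mathbb{E}[\mathfrak{B}_\mu(V)\mathfrak{B}_\mu(V')]=\int_{\mathbb{H}_d}\mathbf{1}_{V\cap V'}(\rho,s)\,d\rho\,\mu(ds)$. The field $B_\mu$ is defined by $B_\mu(t)=\mathfrak{B}_\mu(V_t)$, and $B_\mu$ denotes throughout a separable modification of this field. Hölder exponent: for a locally bounded $f:\mathbb{R}^d\to\mathbb{R}$, $t_0\in\mathbb{R}^d$ and $\alpha>0$, $f\in C^\alpha(t_0)$ if there are $C>0$ and a polynomial $P_{t_0}$ of degree less than $\alpha$ with $|f(t)-P_{t_0}(t)|\le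 C\|t-t_0\|^\alpha$ for all $t$ in a neighborhood of $t_0$; $\alpha_f(t_0)\in[0,\infty]$ is the supremum of all such $\alpha$ (equal to $0$ if there is none). Spectrum: for $h\in[0,\infty]$ let $E_f(h)=\{t:\alpha_f(t)=h\}$, and for nonempty open $W\subseteq\mathbb{R}^d$ let $d_f(h,W)=\dim_{\rm H}(E_f(h)\cap W)$ (Hausdorff dimension, with $\dim_{\rm H}\emptyset=-\infty$). A random field $Y$ is homogeneous if there is a deterministic function $h\mapsto d_Y(h)$ such that almost surely, for all $h\in[0,\infty]$ and all nonempty open $W$, $d_Y(h,W)=d_Y(h)$. The support of the spectrum is the set of $h$ with $d_Y(h)\ge 0$. A homogeneous field is mono-Hölder if this support is reduced to a single point. *)

(* Defs.v *)
From HB Require Import structures.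
From mathcomp Require Import all_boot all_order all_algebra.
From mathcomp Require Import all_classical all_reals all_analysis.
From mathcomp Require mpoly.
(* The notations of mpoly clash with those of MathComp-Analysis. *)
Import (canonicals, coercions) mpoly.

Set Implicit Arguments.
Unset Strict Implicit.
Unset Printing Implicit Defensive.

Import Order.TTheory GRing.Theory Num.Theory.
Import numFieldNormedType.Exports.

Local Open Scope classical_set_scope.
Local Open Scope ring_scope.

(* The library norm on 'rV[R]_n is the sup norm. It induces the same topology
   as the Euclidean norm below, so [open], [nbhs] and [dense] are the usual
   ones; metric quantities (sphere, Hölder bounds, diameters) use [enorm]. *)
Section euclidean.
Context {R : realType} {n : nat}.
Implicit Types x y : 'rV[R]_n.

Definition inner x y : R := \sum_i x ord0 i * y ord0 i.

Definition enorm x : R := Num.sqrt (inner x x).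

Lemma innerNN x : inner (- x) (- x) = inner x x.
Proof. by apply: eq_bigr => i _; rewrite !mxE mulrNN. Qed.

Lemma enormN x : enorm (- x) = enorm x.
Proof. by rewrite /enorm innerNN. Qed.

End euclidean.

(* The sphere of R^(d.+1), so that the dimension d.+1 ranges over all
   integers >= 1. *)
Section sphere.
Context (R : realType) (d : nat).

Definition unit_sphere : set 'rV[R]_d.+1 := [set s | enorm s = 1].

Lemma unit_sphere_delta : unit_sphere (delta_mx ord0 ord0).
Proof.
rewrite /unit_sphere/= /enorm /inner (bigD1 ord0)//= big1 => [|i /negbTE i0].
  by rewrite !mxE !eqxx addr0 mulr1 sqrtr1.
by rewrite !mxE i0 andbF mulr0.
Qed.

(* [set_type] carries the topology induced by the inclusion in R^(d.+1). *)
Definition sphere_top : Type := set_type unit_sphere.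

HB.instance Definition _ := Topological.copy sphere_top (set_type unit_sphere).
HB.instance Definition _ :=
  isPointed.Build sphere_top (exist (fun s => s \in unit_sphere) _ (mem_set unit_sphere_delta)).

(* The sphere with its Borel sigma-algebra. *)
Definition sphere := g_sigma_algebraType (@open sphere_top).

HB.instance Definition _ :=
  Measurable.copy sphere (g_sigma_algebraType (@open sphere_top)).

Definition sphere_val (s : sphere) : 'rV[R]_d.+1 := set_val (s : sphere_top).

Lemma sphere_valP (s : sphere) : unit_sphere (sphere_val s).
Proof. exact: set_valP. Qed.

Lemma unit_sphereN (s : sphere) : unit_sphere (- sphere_val s).
Proof. by rewrite /unit_sphere/= enormN; exact: sphere_valP. Qed.

Definition antipode (s : sphere) : sphere :=
  exist (fun s => s \in unit_sphere) _ (mem_set (unit_sphereN s)).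

End sphere.

Definition symmetric_measure (R : realType) (d : nat)
    (mu : set (sphere R d) -> \bar R) : Prop :=
  forall A, measurable A -> mu (@antipode R d @^-1` A) = mu A.

(* Subsets of H_d = (0, oo) x S^(d-1) are encoded as subsets of
   R x S^(d-1) included in [halfcyl]. *)
Section halfcylinder.
Context {R : realType} {d : nat}.

Definition halfcyl : set (R * sphere R d) := [set x | 0 < x.1].

Definition bounded_borel (V : set (R * sphere R d)) : Prop :=
  [/\ measurable V, V `<=` halfcyl & exists M, forall x, V x -> x.1 <= M].

Definition Vset (t : 'rV[R]_d.+1) : set (R * sphere R d) :=
  halfcyl `&` [set x | x.1 < inner (sphere_val x.2) t].

End halfcylinder.

Section gaussian.
Local Open Scope ereal_scope.
Context {R : realType} {dO : measure_display} {Omega : measurableType dO}.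
Variable P : probability Omega R.

(* The library's [normal_prob m 0] is the uniform law on [0, 1], whence the
   separate treatment of the degenerate case. *)
Definition gaussian_law (m s : R) (A : set R) : \bar R :=
  if s == 0%R then \d_m A else normal_prob m s A.

(* [X] is only constrained on the indices in [I]. *)
Definition gaussian_process (T : Type) (I : set T) (X : T -> {RV P >-> R}) :
    Prop :=
  forall (n : nat) (v : 'I_n -> T) (a : 'I_n -> R), (forall i, I (v i)) ->
  exists m s : R, forall A : set R, measurable A ->
    P [set w | A (\sum_i a i * X (v i) w)%R] = gaussian_law m s A.

Definition centered_on (T : Type) (I : set T) (X : T -> {RV P >-> R}) : Prop :=
  forall v, I v -> 'E_P[X v] = 0.

Definition white_noise (d : nat)
    (mu : {finite_measure set (sphere R d) -> \bar R})
    (G : set (R * sphere R d) -> {RV P >-> R}) : Prop :=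
  [/\ gaussian_process bounded_borel G,
      centered_on bounded_borel G &
      forall V V', bounded_borel V -> bounded_borel V' ->
        'E_P[G V \* G V'] =
        \int[lebesgue_measure \x mu]_(x in halfcyl) (\1_(V `&` V') x)%:E].

Definition modification (T : Type) (X Y : T -> {RV P >-> R}) : Prop :=
  forall t, {ae P, forall w, Y t w = X t w}.

Definition separable_field (n : nat) (Y : 'rV[R]_n -> {RV P >-> R}) : Prop :=
  exists D : set 'rV[R]_n, [/\ countable D, dense D &
    {ae P, forall w, forall (U : set 'rV[R]_n) (F : set R),
      open U -> closed F ->
      (forall t, U t -> D t -> F (Y t w)) -> forall t, U t -> F (Y t w)}].

End gaussian.

Section hoelder_exponent.
Context {R : realType} {n : nat}.

(* [mmeasure mdeg p] is the total degree plus one, and 0 for p = 0; the zero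
   polynomial thus counts as having degree 0, harmlessly since alpha > 0. *)
Definition pointwise_holder (f : 'rV[R]_n -> R) (t0 : 'rV[R]_n) (alpha : R) :
    Prop :=
  exists2 C : R, 0 < C & exists2 p : mpoly.mpoly n R,
    ((mpoly.mmeasure (@mpoly.mdeg n) p).-1)%:R < alpha &
    \forall t \near t0,
      `|f t - mpoly.meval (fun i => t ord0 i) p| <= C * enorm (t - t0) `^ alpha.

(* The added 0 gives the value 0 when f belongs to no C^alpha(t0). *)
Definition holder_exponent (f : 'rV[R]_n -> R) (t0 : 'rV[R]_n) : \bar R :=
  ereal_sup [set alpha%:E |
    alpha in [set alpha | alpha = 0 \/ 0 < alpha /\ pointwise_holder f t0 alpha]].

End hoelder_exponent.

Section hausdorff.
Local Open Scope ereal_scope.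
Context {R : realType} {n : nat}.
Implicit Types A : set 'rV[R]_n.

Definition ediam A : \bar R :=
  ereal_sup [set (enorm (x - y))%:E | x in A & y in A].

(* Convention: the empty set contributes 0 and a point contributes 1 when
   s = 0, so that the measure for s = 0 is the counting measure. *)
Definition diam_pow (s : R) A : \bar R :=
  if A == set0 then 0 else ediam A `^ s.

Definition hausdorff_content (s delta : R) A : \bar R :=
  ereal_inf [set \sum_(0 <= k <oo) diam_pow s (F k) |
    F in [set F : (set 'rV[R]_n)^nat |
      A `<=` \bigcup_k F k /\ forall k, ediam (F k) <= delta%:E]].

Definition hausdorff_measure (s : R) A : \bar R :=
  ereal_sup [set hausdorff_content s delta A | delta in [set x : R | (0 < x)%R]].

Definition hausdorff_dim A : \bar R :=
  if A == set0 then -oo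
  else ereal_inf [set s%:E |
    s in [set s : R | (0 <= s)%R /\ hausdorff_measure s A = 0]].

End hausdorff.

Section spectrum.
Local Open Scope ereal_scope.
Context {R : realType} {n : nat}.

Definition iso_holder (f : 'rV[R]_n -> R) (h : \bar R) : set 'rV[R]_n :=
  [set t | holder_exponent f t = h].

Definition local_spectrum (f : 'rV[R]_n -> R) (h : \bar R)
    (W : set 'rV[R]_n) : \bar R :=
  hausdorff_dim (iso_holder f h `&` W).

Context {dO : measure_display} {Omega : measurableType dO}.
Variable P : probability Omega R.

Definition has_spectrum (Y : 'rV[R]_n -> {RV P >-> R}) (D : \bar R -> \bar R) :
    Prop :=
  {ae P, forall w, forall (h : \bar R) (W : set 'rV[R]_n),
    0 <= h -> open W -> W !=set0 -> local_spectrum (fun t => Y t w) h W = D h}.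

Definition homogeneous (Y : 'rV[R]_n -> {RV P >-> R}) : Prop :=
  exists D, has_spectrum Y D.

Definition spectrum_support (D : \bar R -> \bar R) : set (\bar R) :=
  [set h | 0 <= h /\ 0 <= D h].

Definition mono_holder (Y : 'rV[R]_n -> {RV P >-> R}) : Prop :=
  exists D, has_spectrum Y D /\ exists h0, spectrum_support D = [set h0].

End spectrum.

(* Main.v *)
(** The covariance of the white noise determines the law of every finite linear
combination of values of [B]. By symmetry of [mu], the increment between [t]
and [u] is a centered Gaussian variable of variance the integral of
[|<s, t - u>| / 2] against [mu]; this is at most [C |t - u|], and since
[mu != 0] it is [c |t - u|] with [c > 0] when [t - u] is parallel to a suitable
coordinate vector [e].

The exponent is at least 1/2 by the Kolmogorov-Chentsov argument: Gaussian tails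
and the Borel-Cantelli lemma bound the increments between neighbouring dyadic
points, chaining bounds the increments between the points of the countable
separating set, and separability reaches all points.

It is at most 1/2 by the Paley-Wiener-Zygmund argument: along a line of direction
[e] the sets [V_t] are, over each ray [(0, oo) x {s}], monotone in [t], so that
disjoint increments are independent, and [K] consecutive increments of step [h]
are all smaller than [eps] with probability at most
[(C eps / sqrt h) ^ K]. Taking [eps = h ^ g] with [g > 1/2] and [K] large, a
union bound over a grid of step [h = 2 ^ -n] shows that almost surely no point
has [K] such increments in its vicinity for large [n]. The Taylor polynomial in
the definition of the exponent is harmless because it is locally Lipschitz.

Hence all the points have exponent 1/2 simultaneously, and the spectrum is
homogeneous because all nonempty open sets have the same Hausdorff dimension:
the vanishing of the s-dimensional Hausdorff measure is invariant under
similitudes and countable unions, so the dimension need not be computed. *)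
Require Import Defs.
From mathcomp Require Import all_boot all_order all_algebra.
From mathcomp Require Import all_classical all_reals all_analysis.
From mathcomp Require mpoly.
From mathcomp Require Import measurable_realfun ring lra.

Set Implicit Arguments.
Unset Strict Implicit.
Unset Printing Implicit Defensive.

Import Order.TTheory GRing.Theory Num.Theory.
Import numFieldNormedType.Exports.

Local Open Scope classical_set_scope.
Local Open Scope ring_scope.

(** * Gaussian integrals *)

Section gaussian_integrals.
Context {R : realType}.
Notation leb := (@lebesgue_measure R).

(** On [-n, n] the integral is F(n) - F(-n), and dominated convergence lets n tend to infinity.
    Every integration by parts below takes this form, with [F] the boundary term. *)
Lemma integral_derive0 (F f : R -> R) :
  (forall x : R, is_derive x 1 F (f x)) -> continuous f ->
  leb.-integrable setT (EFin \o f) ->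
  F n%:R @[n --> \oo] --> 0 -> F (- n%:R) @[n --> \oo] --> 0 ->
  (\int[leb]_x (f x)%:E = 0)%E.
Proof.
move=> dF cf intf Fy FNy.
pose I n : set R := `[- n%:R, n%:R]%classic.
pose g n := (EFin \o f) \_ (I n).
have mI n : measurable (I n) by exact: measurable_itv.
have mf : measurable_fun setT (EFin \o f) by case/integrableP : intf.
have mg n : measurable_fun setT (g n).
  by apply/(measurable_restrictT _ _).1 => //; exact: measurable_funTS.
have gf : {ae leb, forall x : R, setT x -> (g ^~ x) @ \oo --> (EFin \o f) x}.
  apply: aeW => x _; apply: cvg_near_cst.
  near=> n; rewrite /g patchE mem_set// /I /= in_itv/= -ler_norml.
  by near: n; exact: nbhs_infty_ger.
have gub : {ae leb, forall (x : R) (n : nat), setT x ->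
    (`|g n x| <= (abse \o (EFin \o f)) x)%E}.
  apply: aeW => x n _; rewrite /g patchE; case: ifP => _; first exact: lexx.
  by rewrite -[point]/(0%E : \bar R) abse0 abse_ge0.
have intaf : leb.-integrable setT (abse \o (EFin \o f)).
  exact: integrable_abse.
have [_ _ cv] := @dominated_convergence _ _ _ leb setT measurableT g
  (EFin \o f) _ mg mf gf intaf gub.
have cv0 : (\int[leb]_x g n x)%E @[n --> \oo] --> 0%E.
  have -> : 0%E = (0 - 0)%:E :> \bar R by rewrite subr0.
  apply: (@cvg_trans _ ((F n%:R - F (- n%:R))%:E @[n --> \oo])); last first.
    apply: cvg_EFin; first by near=> n.
    by apply: cvgB.
  apply: near_eq_cvg; near=> n.
  rewrite /g -integral_mkcond.
  have n0 : - n%:R < n%:R :> R.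
    rewrite gtrN// ltr0n; near: n; exact: nbhs_infty_gt.
  rewrite (@continuous_FTC2 _ f F)//.
  - exact: continuous_subspaceT.
  - have cF x : {for x, continuous F}.
      by apply/differentiable_continuous/derivable1_diffP; have [] := dF x.
    split.
    + by move=> x _; have [] := dF x.
    + exact/cvg_at_right_filter/cF.
    + exact/cvg_at_left_filter/cF.
  - by move=> x _; rewrite derive1E; have [_ ->] := dF x.
by apply: cvg_unique cv cv0; exact: ereal_hausdorff.
Unshelve. all: end_near. Qed.

Lemma expR_gtN (y : R) : 0 <= y -> y * expR (- y) <= 1.
Proof.
move=> y0; rewrite expRN ler_pdivrMr ?expR_gt0// mul1r.
by apply: le_trans (expR_ge1Dx y); rewrite lerDr.
Qed.

Variable s : R.
Hypothesis s0 : s != 0.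

Lemma sqr_gt0 : 0 < s ^+ 2. Proof. by rewrite exprn_even_gt0. Qed.

Lemma is_derive_normal_pdf (m x : R) :
  is_derive x 1 (normal_pdf m s) (- ((x - m) / s ^+ 2) * normal_pdf m s x).
Proof.
rewrite normal_pdfE//.
pose q (y : R) := - (y - m) ^+ 2 / (s ^+ 2 *+ 2).
have dq : is_derive x 1 q (- ((x - m) / s ^+ 2)).
  rewrite /q; apply: is_derive_eq.
  rewrite /GRing.scale/=.
  by field.
have -> : (fun y => normal_peak s * normal_fun m s y) =
    (fun y => normal_peak s * expR (q y)) by [].
have -> : normal_fun m s x = expR (q x) by [].
apply: is_derive_eq.
rewrite /GRing.scale/=; by ring.
Qed.

Lemma sqr_normal_fun_le (m x : R) :
  (x - m) ^+ 2 * normal_fun m s x <= 2 * s ^+ 2.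
Proof.
have s2 := sqr_gt0.
pose y := (x - m) ^+ 2 / (s ^+ 2 *+ 2).
have y0 : 0 <= y by rewrite divr_ge0 ?sqr_ge0// mulrn_wge0// sqr_ge0.
have -> : normal_fun m s x = expR (- y) by rewrite /normal_fun /y mulNr.
have -> : (x - m) ^+ 2 = (2 * s ^+ 2) * y by rewrite /y; field.
by rewrite -mulrA ler_piMr ?expR_gtN// mulr_ge0// ltW.
Qed.

Lemma sqr_normal_pdf_le (m x : R) :
  (x - m) ^+ 2 * normal_pdf m s x <= 2 * s ^+ 2 * normal_peak s.
Proof.
rewrite normal_pdfE// mulrCA mulrC ler_wpM2r ?normal_peak_ge0//.
exact: sqr_normal_fun_le.
Qed.

(** The bound gives |F(n)|, |F(-n)| <= C / n; it is easy to check for a normal density multiplied by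
    a factor of at most linear growth. *)
Lemma integral_derive0_le (F f : R -> R) (C : R) :
  (forall x : R, is_derive x 1 F (f x)) -> continuous f ->
  leb.-integrable setT (EFin \o f) -> (forall x, `|x| * `|F x| <= C) ->
  (\int[leb]_x (f x)%:E = 0)%E.
Proof.
move=> dF cf intf FC.
have C0 : 0 <= C by apply: le_trans (FC 0); rewrite mulr_ge0.
have F0 (h : nat -> R) : (forall n, `|h n| = n%:R) -> F (h n) @[n --> \oo] --> 0.
  move=> hn; apply/cvgrPdist_le => /= e e0; near=> n.
  have n0 : 0 < n%:R :> R by rewrite ltr0n; near: n; exact: nbhs_infty_gt.
  rewrite sub0r normrN -(ler_pM2l n0) -(hn n); apply: le_trans (FC _) _.
  rewrite hn -ler_pdivrMr//; near: n; exact: nbhs_infty_ger.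
apply: (integral_derive0 dF cf intf); apply: F0 => n; first exact: normr_nat.
by rewrite normrN normr_nat.
Unshelve. all: end_near. Qed.

(** Half of the Gaussian exponent absorbs the square: with y = (x - m)^2 / 4 s^2 the exponential is
    e^(-y) e^(-y), one factor is used in y e^(-y) <= 1, and the other is a normal density of
    deviation s sqrt 2 up to a constant. *)
Lemma integrable_sqr_normal_pdf (m : R) : leb.-integrable setT
  (fun x => ((x - m) ^+ 2 * normal_pdf m s x)%:E).
Proof.
have s2 := sqr_gt0.
have r2 : Num.sqrt 2 != 0 :> R by rewrite gt_eqF// sqrtr_gt0.
have s20 : s * Num.sqrt 2 != 0 by rewrite mulf_neq0.
pose k := 4 * s ^+ 2 * normal_peak s / normal_peak (s * Num.sqrt 2).
apply: (@le_integrable _ _ _ leb setT measurableT _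
   (fun x => (k * normal_pdf m (s * Num.sqrt 2) x)%:E)).
- apply/measurable_EFinP; apply: measurable_funM; last exact: measurable_normal_pdf.
  by apply: measurable_funX; exact: measurable_funB.
- move=> x _ /=; rewrite lee_fin.
  have k0 : 0 <= k.
    by rewrite divr_ge0 ?normal_peak_ge0// mulr_ge0 ?normal_peak_ge0// mulr_ge0// ltW.
  rewrite [leRHS]ger0_norm ?(mulr_ge0 k0 (normal_pdf_ge0 _ _ _))//.
  rewrite ger0_norm ?(mulr_ge0 (sqr_ge0 _) (normal_pdf_ge0 _ _ _))//.
  rewrite !normal_pdfE// /k [leRHS]mulrA divfK ?gt_eqF ?normal_peak_gt0//.
  rewrite mulrCA [leRHS]mulrAC [leRHS]mulrC ler_wpM2l ?normal_peak_ge0//.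
  pose y := (x - m) ^+ 2 / (s ^+ 2 * 4).
  have y0 : 0 <= y by rewrite divr_ge0 ?sqr_ge0// mulr_ge0// ltW.
  have -> : normal_fun m s x = expR (- y) * expR (- y).
    by rewrite -expRD /normal_fun /y; congr expR; field.
  have -> : normal_fun m (s * Num.sqrt 2) x = expR (- y).
    by rewrite /normal_fun /y exprMn sqr_sqrtr//; congr expR; field.
  have -> : (x - m) ^+ 2 = (4 * s ^+ 2) * y by rewrite /y; field.
  set e := expR _; set c := 4 * _.
  have -> : c * y * (e * e) = c * (y * e) * e by ring.
  by rewrite ler_wpM2r ?expR_ge0// ler_piMr ?expR_gtN// mulr_ge0// ltW.
- apply: (@integrableZl _ _ _ leb setT measurableT k
    (fun x => (normal_pdf m (s * Num.sqrt 2) x)%:E)).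
  exact: integrable_normal_pdf.
Qed.

Lemma integrable_lin_normal_pdf (m : R) : leb.-integrable setT
  (fun x => ((x - m) * normal_pdf m s x)%:E).
Proof.
apply: (@le_integrable _ _ _ leb setT measurableT _
   (fun x => (normal_pdf m s x)%:E + ((x - m) ^+ 2 * normal_pdf m s x)%:E)%E).
- apply/measurable_EFinP; apply: measurable_funM; last exact: measurable_normal_pdf.
  exact: measurable_funB.
- move=> x _ /=; rewrite lee_fin.
  rewrite [leRHS]ger0_norm ?(addr_ge0 (normal_pdf_ge0 _ _ _)
    (mulr_ge0 (sqr_ge0 _) (normal_pdf_ge0 _ _ _)))//.
  rewrite normrM (ger0_norm (normal_pdf_ge0 _ _ _)).
  rewrite -{2}[normal_pdf m s x]mul1r -mulrDl ler_wpM2r ?normal_pdf_ge0//.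
  rewrite -real_normK ?num_real//; set u := `|_|.
  have u0 : 0 <= u by exact: normr_ge0.
  by have := sqr_ge0 (u - 1); nra.
- apply: integrableD => //; first exact: integrable_normal_pdf.
  exact: integrable_sqr_normal_pdf.
Qed.

(** An antiderivative of the integrand is [- s ^+ 2 * normal_pdf m s x]. *)
Lemma integral_lin_normal_pdf (m : R) :
  (\int[leb]_x ((x - m) * normal_pdf m s x)%:E = 0)%E.
Proof.
pose C := (normal_peak s) * (1 + `|m|) + 2 * s ^+ 2 * normal_peak s.
have := @integral_derive0_le (fun x => - s ^+ 2 * normal_pdf m s x)
  (fun x => (x - m) * normal_pdf m s x) (s ^+ 2 * C).
apply.
- move=> x; have d := is_derive_normal_pdf m x.
  apply: is_derive_eq.
  by rewrite /GRing.scale/=; field.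
- move=> x; apply: cvgM; last exact: continuous_normal_pdf.
  by apply: cvgB; [exact: cvg_id|exact: cvg_cst].
- exact: integrable_lin_normal_pdf.
- move=> x; rewrite normrM normrN (ger0_norm (sqr_ge0 _)) mulrCA.
  rewrite ler_wpM2l ?sqr_ge0// (ger0_norm (normal_pdf_ge0 _ _ _)).
  have xu : `|x| <= 1 + `|m| + (x - m) ^+ 2.
    have : `|x| <= `|x - m| + `|m| by rewrite -{1}(subrK m x) ler_normD.
    rewrite -(real_normK (num_real (x - m))); set u := `|x - m|.
    have u0 : 0 <= u by exact: normr_ge0.
  by have := sqr_ge0 (u - 1); nra.
  apply: le_trans (ler_wpM2r (normal_pdf_ge0 _ _ _) xu) _.
  rewrite mulrDl lerD ?sqr_normal_pdf_le// mulrC ler_wpM2r ?addr_ge0//.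
  exact: normal_pdf_ub.
Qed.

(** The derivative of - s^2 x phi(x), with phi the density, is (x^2 - s^2) phi(x); hence the second
    moment is s^2 times the total mass. *)
Lemma integral_sqr_normal_pdf :
  (\int[leb]_x (x ^+ 2 * normal_pdf 0 s x)%:E = (s ^+ 2)%:E)%E.
Proof.
pose f x := x ^+ 2 * normal_pdf 0 s x - s ^+ 2 * normal_pdf 0 s x.
have i2 : leb.-integrable setT (fun x => (x ^+ 2 * normal_pdf 0 s x)%:E).
  have := integrable_sqr_normal_pdf 0.
  by under eq_fun do rewrite subr0.
have i0 : leb.-integrable setT (fun x => (s ^+ 2 * normal_pdf 0 s x)%:E).
  apply: (@integrableZl _ _ _ leb setT measurableT (s ^+ 2)
    (fun x => (normal_pdf 0 s x)%:E)).
  exact: integrable_normal_pdf.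
have : (\int[leb]_x (f x)%:E = 0)%E.
  apply: (@integral_derive0_le (fun x => - s ^+ 2 * (x * normal_pdf 0 s x)) f
    (s ^+ 2 * (2 * s ^+ 2 * normal_peak s))).
  - move=> x; have := is_derive_normal_pdf 0 x; rewrite subr0 => d.
    apply: is_derive_eq.
    by rewrite /GRing.scale/= /f; field.
  - have c := @continuous_normal_pdf R 0 s s0.
    move=> x; apply: cvgB; apply: cvgM; try exact: c.
      exact: exprn_continuous.
    exact: cvg_cst.
  - have -> : EFin \o f = (fun x => (x ^+ 2 * normal_pdf 0 s x)%:E -
        (s ^+ 2 * normal_pdf 0 s x)%:E)%E by [].
    exact: integrableB.
  - move=> x; rewrite normrM normrN (ger0_norm (sqr_ge0 _)) mulrCA.
    rewrite ler_wpM2l ?sqr_ge0// normrM mulrA -expr2 real_normK ?num_real//.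
    rewrite ger0_norm ?normal_pdf_ge0//.
    by have := sqr_normal_pdf_le 0 x; rewrite subr0.
have -> : (fun x => (f x)%:E) = (fun x => (x ^+ 2 * normal_pdf 0 s x)%:E -
        (s ^+ 2 * normal_pdf 0 s x)%:E)%E by [].
rewrite integralB//.
have -> : (\int[leb]_x (s ^+ 2 * normal_pdf 0 s x)%:E = (s ^+ 2)%:E)%E.
  under eq_integral do rewrite EFinM.
  rewrite integralZl//; last exact: integrable_normal_pdf.
  by rewrite integral_normal_pdf mule1.
rewrite -(fineK (integrable_fin_num measurableT i2)) -EFinB => -[] /eqP.
by rewrite subr_eq0 => /eqP ->.
Qed.


(** The characteristic function of the centered normal law: its imaginary part vanishes by symmetry,
    so that real cosines suffice throughout. *)
Definition gauss_cos (t : R) : R := \int[leb]_x (cos (t * x) * normal_pdf 0 s x).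

Lemma integrable_bounded_normal_pdf (f : R -> R) (M : R) :
  measurable_fun setT f -> (forall x, `|f x| <= M) ->
  leb.-integrable setT (fun x => (f x * normal_pdf 0 s x)%:E).
Proof.
move=> mf fM.
apply: (@le_integrable _ _ _ leb setT measurableT _
   (fun x => (M * normal_pdf 0 s x)%:E)).
- apply/measurable_EFinP; apply: measurable_funM => //.
  exact: measurable_normal_pdf.
- move=> x _ /=; rewrite lee_fin !normrM ler_wpM2r//.
  exact: le_trans (ler_norm _).
- apply: (@integrableZl _ _ _ leb setT measurableT M
    (fun x => (normal_pdf 0 s x)%:E)).
  exact: integrable_normal_pdf.
Qed.

Lemma measurable_cos : measurable_fun setT (@cos R).
Proof. by apply: continuous_measurable_fun => x; exact: continuous_cos. Qed.

Lemma measurable_sin : measurable_fun setT (@sin R).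
Proof. by apply: continuous_measurable_fun => x; exact: continuous_sin. Qed.

Lemma measurable_cosZ (t : R) : measurable_fun setT (fun x : R => cos (t * x)).
Proof.
by apply: measurableT_comp (measurable_cos) _; exact: measurable_funM.
Qed.

Lemma measurable_sinZ (t : R) : measurable_fun setT (fun x : R => sin (t * x)).
Proof.
by apply: measurableT_comp (measurable_sin) _; exact: measurable_funM.
Qed.

Lemma integrable_cos (t : R) :
  leb.-integrable setT (fun x => (cos (t * x) * normal_pdf 0 s x)%:E).
Proof.
apply: (@integrable_bounded_normal_pdf _ 1); first exact: measurable_cosZ.
by move=> x; rewrite ler_norml cos_geN1 cos_le1.
Qed.

Lemma integrable_abs_normal_pdf : leb.-integrable setT
  (fun x => (`|x| * normal_pdf 0 s x)%:E).
Proof.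
have := integrable_abse (integrable_lin_normal_pdf 0).
apply: eq_integrable => // x _ /=.
by rewrite subr0 normrM (ger0_norm (normal_pdf_ge0 _ _ _)).
Qed.

Lemma integrable_xsin (t : R) :
  leb.-integrable setT (fun x => (x * sin (t * x) * normal_pdf 0 s x)%:E).
Proof.
apply: (@le_integrable _ _ _ leb setT measurableT _
   (fun x => (`|x| * normal_pdf 0 s x)%:E)).
- apply/measurable_EFinP; apply: measurable_funM; last exact: measurable_normal_pdf.
  by apply: measurable_funM => //; exact: measurable_sinZ.
- move=> x _ /=; rewrite lee_fin !normrM normr_id ler_wpM2r// ler_piMr//.
  by rewrite ler_norml sin_geN1 sin_le1.
- exact: integrable_abs_normal_pdf.
Qed.

(** Integration by parts with boundary term s^2 sin(t x) phi(x). *)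
Lemma gauss_cos_xsin (t : R) :
  \int[leb]_x (x * sin (t * x) * normal_pdf 0 s x) = t * s ^+ 2 * gauss_cos t.
Proof.
pose f x := t * s ^+ 2 * (cos (t * x) * normal_pdf 0 s x) -
  x * sin (t * x) * normal_pdf 0 s x.
have i1 : leb.-integrable setT
    (fun x => (t * s ^+ 2 * (cos (t * x) * normal_pdf 0 s x))%:E).
  by apply: (@integrableZl _ _ _ leb setT measurableT (t * s ^+ 2)
    (fun x => (cos (t * x) * normal_pdf 0 s x)%:E)); exact: integrable_cos.
have : \int[leb]_x f x = 0.
  rewrite /Rintegral.
  suff -> : (\int[leb]_x (f x)%:E = 0)%E by [].
  apply: (@integral_derive0_le (fun x => s ^+ 2 * (sin (t * x) * normal_pdf 0 s x)) f
    (s ^+ 2 * (normal_peak s + 2 * s ^+ 2 * normal_peak s))).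
  - move=> x; have := is_derive_normal_pdf 0 x; rewrite subr0 => d.
    have d2 : is_derive x 1 (fun x : R => t * x) t.
      by apply: is_derive_eq; rewrite /GRing.scale/=; ring.
    have d3 : is_derive x 1 (fun x : R => sin (t * x)) (cos (t * x) * t).
      exact: (is_derive1_comp (f := sin) (g := fun x => t * x)).
    apply: is_derive_eq.
    by rewrite /GRing.scale/= /f; field.
  - have c := @continuous_normal_pdf R 0 s s0.
    have cm (x : R) : (fun x : R => t * x) @ x --> t * x.
      by apply: cvgM; [exact: cvg_cst|exact: cvg_id].
    move=> x; apply: cvgB.
      apply: cvgM; first exact: cvg_cst.
      apply: cvgM; last exact: c.
      apply: (cvg_comp _ (@cos R) (cm x)); exact: continuous_cos.
    apply: cvgM; last exact: c.
    apply: cvgM; first exact: cvg_id.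
    apply: (cvg_comp _ (@sin R) (cm x)); exact: continuous_sin.
  - have -> : EFin \o f = (fun x => (t * s ^+ 2 * (cos (t * x) * normal_pdf 0 s x))%:E -
        (x * sin (t * x) * normal_pdf 0 s x)%:E)%E by [].
    apply: integrableB => //; exact: integrable_xsin.
  - move=> x; rewrite normrM (ger0_norm (sqr_ge0 _)) mulrCA.
    rewrite ler_wpM2l ?sqr_ge0//.
    rewrite normrM (ger0_norm (normal_pdf_ge0 _ _ _)).
    have s1 : `|sin (t * x)| <= 1 by rewrite ler_norml sin_geN1 sin_le1.
    apply: (@le_trans _ _ (`|x| * normal_pdf 0 s x)).
      by rewrite ler_wpM2l// ler_piMl// normal_pdf_ge0.
    have xu : `|x| <= 1 + x ^+ 2.
      rewrite -(real_normK (num_real x)); set u := `|x|.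
      have u0 : 0 <= u by exact: normr_ge0.
      by have := sqr_ge0 (u - 1); nra.
    apply: le_trans (ler_wpM2r (normal_pdf_ge0 _ _ _) xu) _.
    rewrite mulrDl mul1r lerD ?normal_pdf_ub//.
    by have := sqr_normal_pdf_le 0 x; rewrite subr0.
rewrite RintegralB//; last exact: integrable_xsin.
rewrite RintegralZl//; last exact: integrable_cos.
by move/eqP; rewrite subr_eq0 => /eqP <-.
Qed.

(** Differentiation under the integral sign, dominated by |x| phi(x) uniformly in the parameter;
    [gauss_cos_xsin] expresses the result through [gauss_cos] itself. *)
Lemma is_derive_gauss_cos (t : R) :
  is_derive t 1 gauss_cos (- (t * s ^+ 2 * gauss_cos t)).
Proof.
pose f (t x : R) := cos (t * x) * normal_pdf 0 s x.
have df (u x : R) : is_derive u 1 (f ^~ x) (- (x * sin (u * x) * normal_pdf 0 s x)).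
  have d2 : is_derive u 1 (fun u : R => u * x) x.
    by apply: is_derive_eq; rewrite /GRing.scale/=; ring.
  have d3 : is_derive u 1 (fun u : R => cos (u * x)) (- sin (u * x) * x).
    exact: (is_derive1_comp (f := cos) (g := fun u => u * x)).
  apply: is_derive_eq.
  by rewrite /GRing.scale/=; ring.
have Ia : `]t - 1, t + 1[%classic t.
  by rewrite /= in_itv/= ltrBlDr ltrDl ltr01.
have h1 u : `]t - 1, t + 1[%classic u -> leb.-integrable setT (EFin \o f u).
  by move=> _; exact: integrable_cos.
have h2 u (y : R) : `]t - 1, t + 1[%classic u -> setT y -> derivable (f ^~ y) u 1.
  by move=> _ _; have [] := df u y.
have h3 (y : R) : 0 <= `|y| * normal_pdf 0 s y.
  by rewrite mulr_ge0// normal_pdf_ge0.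
have h4 u (y : R) : `]t - 1, t + 1[%classic u -> setT y ->
    `|partial1of2 f u y| <= `|y| * normal_pdf 0 s y.
  move=> _ _; rewrite partial1of2E; have [_ ->] := df u y.
  rewrite normrN !normrM (ger0_norm (normal_pdf_ge0 _ _ _)).
  rewrite ler_wpM2r ?normal_pdf_ge0// ler_piMr//.
  by rewrite ler_norml sin_geN1 sin_le1.
have d := @derivable_under_integral R _ _ leb f setT measurableT t (t - 1) (t + 1)
  Ia h1 h2 _ h3 integrable_abs_normal_pdf h4.
have := @differentiation_under_integral R _ _ leb f setT measurableT t (t - 1) (t + 1)
  Ia h1 h2 _ h3 integrable_abs_normal_pdf h4.
rewrite derive1E => e.
apply: DeriveDef => //.
rewrite [LHS]e.
under eq_Rintegral do rewrite partial1of2E (derive_val (is_derive := df _ _)).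
rewrite -gauss_cos_xsin -mulN1r -RintegralZl//; last exact: integrable_xsin.
by apply: eq_Rintegral => x _; rewrite mulN1r.
Qed.

(* [gauss_cos] solves the differential equation [y' = - s^2 t y]. *)
Lemma gauss_cosE (t : R) : gauss_cos t = expR (- (s ^+ 2 * t ^+ 2 / 2)).
Proof.
pose g t := gauss_cos t * expR (s ^+ 2 * t ^+ 2 / 2).
have dg (u : R) : is_derive u 1 g 0.
  have d1 := is_derive_gauss_cos u.
  have d2 : is_derive u 1 (fun t : R => s ^+ 2 * t ^+ 2 / 2) (s ^+ 2 * u).
    by apply: is_derive_eq; rewrite /GRing.scale/=; field.
  apply: is_derive_eq.
  by rewrite /GRing.scale/=; ring.
have := is_derive_0_is_cst t 0 dg.
rewrite /g expr0n/= mulr0 mul0r expR0 mulr1.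
have -> : gauss_cos 0 = 1.
  rewrite /gauss_cos /Rintegral.
  under eq_integral do rewrite mul0r cos0 mul1r.
  by rewrite integral_normal_pdf.
set y := _ / 2 => h; rewrite expRN.
by apply: (mulIf (lt0r_neq0 (expR_gt0 y))); rewrite mulVf ?h// gt_eqF ?expR_gt0.
Qed.

Lemma integral_cos_normal_pdf (t : R) :
  (\int[leb]_x (cos (t * x) * normal_pdf 0 s x)%:E =
   (expR (- (s ^+ 2 * t ^+ 2 / 2)))%:E)%E.
Proof.
rewrite -gauss_cosE /gauss_cos /Rintegral fineK//.
exact: (integrable_fin_num measurableT (integrable_cos t)).
Qed.

End gaussian_integrals.

Section gaussian_mixtures.
Context {R : realType}.
Notation leb := (@lebesgue_measure R).

(** The integrand is a multiple of the normal density of deviation s / sqrt(1 + v s^2). A negative v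
    serves the tail bound, a nonnegative one the small-ball bound. *)
Lemma integral_expR_sqr_normal_pdf (s v : R) : s != 0 -> -1 < v * s ^+ 2 ->
  (\int[leb]_x (expR (- (v * x ^+ 2 / 2)) * normal_pdf 0 s x)%:E =
   ((Num.sqrt (1 + v * s ^+ 2))^-1)%:E)%E.
Proof.
move=> s0 vs.
have w0 : 0 < 1 + v * s ^+ 2 by rewrite -ltrBlDl sub0r.
set w := 1 + v * s ^+ 2 in w0 *.
have sw0 : Num.sqrt w != 0 by rewrite gt_eqF// sqrtr_gt0.
pose r := s / Num.sqrt w.
have r0 : r != 0 by rewrite mulf_neq0// invr_neq0.
have pk : normal_peak s = (Num.sqrt w)^-1 * normal_peak r.
  rewrite /normal_peak -invfM; congr (_^-1).
  rewrite -sqrtrM ?ltW//; congr Num.sqrt.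
  rewrite /r expr_div_n sqr_sqrtr ?ltW//.
  by field; rewrite gt_eqF.
have e x : expR (- (v * x ^+ 2 / 2)) * normal_pdf 0 s x =
    (Num.sqrt w)^-1 * normal_pdf 0 r x.
  rewrite !normal_pdfE// pk mulrCA -!mulrA; congr (_ * (_ * _)).
  rewrite /normal_fun -expRD; congr expR.
  rewrite /r expr_div_n sqr_sqrtr ?ltW// subr0 /w.
  by field; rewrite s0 gt_eqF.
under eq_integral do rewrite e EFinM.
rewrite integralZl//; last exact: integrable_normal_pdf.
by rewrite integral_normal_pdf mule1.
Qed.

End gaussian_mixtures.

(** * Gaussian random variables *)

Section gaussian_law.
Context {R : realType} {dO : measure_display} {Omega : measurableType dO}.
Variable P : probability Omega R.
Notation leb := (@lebesgue_measure R).

(** The change of variables goes through the Radon-Nikodym derivative, which agrees almost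
    everywhere with the density because both have the same integral over every measurable set. *)
Lemma ge0_integral_normal_prob (m s : R) (f : R -> \bar R) :
  measurable_fun setT f -> (forall x, 0 <= f x)%E ->
  (\int[normal_prob m s]_x f x = \int[leb]_x (f x * (normal_pdf m s x)%:E))%E.
Proof.
move=> mf f0.
have dom := normal_prob_dominates m s.
rewrite -(Radon_Nikodym_SigmaFinite.change_of_variables dom f0 measurableT mf).
have mpdf : measurable_fun setT (fun x => (normal_pdf m s x)%:E).
  by apply/measurable_EFinP; exact: measurable_normal_pdf.
have iRN := Radon_Nikodym_SigmaFinite.f_integrable dom.
have mRN := measurable_int _ iRN.
apply: ge0_ae_eq_integral => //.
- exact: emeasurable_funM.
- exact: emeasurable_funM.
- move=> x _; rewrite mule_ge0//; exact: Radon_Nikodym_SigmaFinite.f_ge0.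
- by move=> x _; rewrite mule_ge0// lee_fin normal_pdf_ge0.
- apply: ae_eqe_mul2l.
  apply: integral_ae_eq => //.
  by move=> A _ mA; rewrite -Radon_Nikodym_SigmaFinite.f_integral.
Qed.

Section law.
Variables (X : Omega -> R) (m s : R).
Hypothesis mX : measurable_fun setT X.
Hypothesis lawX : forall A, measurable A -> P [set w | A (X w)] = gaussian_law m s A.

Lemma ge0_integral_gaussian (f : R -> \bar R) : s != 0 ->
  measurable_fun setT f -> (forall x, 0 <= f x)%E ->
  (\int[P]_w f (X w) = \int[leb]_x (f x * (normal_pdf m s x)%:E))%E.
Proof.
move=> s0 mf f0; rewrite -ge0_integral_normal_prob//.
have mX' : @measurable_fun _ _ Omega (measurableTypeR R) setT X := mX.
have := @ge0_integral_pushforward _ _ _ (measurableTypeR R) R _ mX' P setT f measurableT mf.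
rewrite preimage_setT => /(_ (fun x _ => f0 x)) <-.
apply: (@eq_measure_integral _ _ R setT (normal_prob m s)) => A mA _.
by have := lawX mA; rewrite /gaussian_law (negbTE s0).
Qed.

Lemma integral_gaussian (f : R -> R) : s != 0 -> measurable_fun setT f ->
  (\int[P]_w (f (X w))%:E = \int[leb]_x (f x * normal_pdf m s x)%:E)%E.
Proof.
move=> s0 mf; rewrite integralE [RHS]integralE.
have mf' : measurable_fun setT (EFin \o f) by exact/measurable_EFinP.
have p0 x : (0 <= (normal_pdf m s x)%:E)%E by rewrite lee_fin normal_pdf_ge0.
congr (_ - _)%E.
  under eq_integral do rewrite funeposE.
  under [RHS]eq_integral do rewrite funeposE EFinM.
  rewrite (@ge0_integral_gaussian (fun x => maxe (f x)%:E 0%E))//.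
  - by apply: eq_integral => x _; rewrite maxe_pMl// mul0e.
  - by apply: measurable_maxe => //; exact: measurable_cst.
  - by move=> x; rewrite le_max lexx orbT.
under eq_integral do rewrite funenegE.
under [RHS]eq_integral do rewrite funenegE EFinM.
rewrite (@ge0_integral_gaussian (fun x => maxe (- (f x)%:E)%E 0%E))//.
- by apply: eq_integral => x _; rewrite maxe_pMl// mul0e mulNe.
- apply: measurable_maxe; last exact: measurable_cst.
  exact: measurableT_comp.
- by move=> x; rewrite le_max lexx orbT.
Qed.

Lemma integral_gaussian0 (f : R -> R) : s = 0 -> measurable_fun setT f ->
  (\int[P]_w (f (X w))%:E = (f m)%:E)%E.
Proof.
move=> s0 mf.
have ae : {ae P, forall w, X w = m}.
  exists (~` [set w | [set m] (X w)]); split.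
  - apply: measurableC; rewrite -[X in measurable X]setTI.
    exact: mX.
  - rewrite probability_setC; last by rewrite -[X in measurable X]setTI; exact: mX.
    rewrite lawX// /gaussian_law s0 eqxx diracE mem_set//.
    by rewrite subee.
  - by move=> w /=.
rewrite (@ae_eq_integral _ _ _ P setT (cst (f m)%:E))//.
- by rewrite integral_cst//= probability_setT mule1.
- by apply/measurable_EFinP; apply: measurableT_comp mX.
- by apply: filterS ae => w /= -> _.
Qed.

End law.

(** Markov's inequality, to be used with exponential weights that are at least 1 on the event. *)
Lemma le_probability_integral (A : set Omega) (f : Omega -> R) :
  measurable A -> measurable_fun setT f -> (forall w, 0 <= f w) ->
  (forall w, A w -> 1 <= f w) -> (P A <= \int[P]_w (f w)%:E)%E.
Proof.
move=> mA mf f0 Af.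
rewrite -(setIT A) -integral_indic//; apply: ge0_le_integral => //=.
- exact/measurable_EFinP/measurable_indic.
- exact/measurable_EFinP.
- move=> w _; rewrite lee_fin indicE; have [/set_mem/Af//|_] := boolP (w \in A).
  exact: f0.
Qed.

(** The parameter is the variance, the quantity that the covariance computes; [s] is one of its
    square roots, and v = 0 gives the Dirac mass at 0. *)
Definition centered_gaussian (X : Omega -> R) (v : R) : Prop :=
  measurable_fun setT X /\ exists2 s, s ^+ 2 = v &
    forall A, measurable A -> P [set w | A (X w)] = gaussian_law 0 s A.

Lemma centered_gaussian_cos (X : Omega -> R) (v t : R) :
  centered_gaussian X v ->
  (\int[P]_w (cos (t * X w))%:E = (expR (- (v * t ^+ 2 / 2)))%:E)%E.
Proof.
move=> [mX [s <- lawX]].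
have [s0|s0] := eqVneq s 0.
  rewrite (integral_gaussian0 mX lawX s0 (measurable_cosZ t)) mulr0 cos0.
  by rewrite s0 expr0n/= !mul0r oppr0 expR0.
rewrite (integral_gaussian mX lawX s0 (measurable_cosZ t)).
exact: integral_cos_normal_pdf.
Qed.

(* From [E exp (X^2 / 4v) = sqrt 2] and [y^m / m! <= exp y]. *)
Lemma centered_gaussian_tail (X : Omega -> R) (v x : R) (m : nat) :
  centered_gaussian X v -> 0 < x ->
  (P [set w | (x < `|X w|)%R] <=
    (Num.sqrt 2 * m`!%:R * (4 * v / x ^+ 2) ^+ m)%R%:E)%E.
Proof.
move=> [mX [s sv lawX]] x0.
have mA : measurable [set y : R | x < `|y|].
  rewrite -[X in measurable X]setTI.
  have -> : [set y : R | x < `|y|] = (@Num.norm _ R) @^-1` `]x, +oo[.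
    by apply/seteqP; split => y /=; rewrite in_itv/= andbT.
  exact: normr_measurable.
have v0 : 0 <= v by rewrite -sv sqr_ge0.
have [s0|s0] := eqVneq s 0.
  rewrite (lawX _ mA) /gaussian_law s0 eqxx diracE memNset; last first.
    by rewrite /= normr0; apply/negP; rewrite -leNgt ltW.
  by rewrite lee_fin !mulr_ge0// exprn_ge0// divr_ge0 ?sqr_ge0// mulr_ge0.
have sp : 0 < s ^+ 2 by rewrite exprn_even_gt0.
(* With this negative weight [expR (- (u * y ^+ 2 / 2))] is exp(y^2 / 4v); the factor [k] below
   makes [f] at least 1 as soon as |y| > x. *)
pose u := - (2 * s ^+ 2)^-1.
pose k := m`!%:R * (4 * v / x ^+ 2) ^+ m.
have vp : 0 < v by rewrite -sv.
have k0 : 0 < k.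
  by rewrite mulr_gt0 ?ltr0n ?fact_gt0// exprn_gt0// divr_gt0 ?exprn_gt0// mulr_gt0.
pose f y := k * expR (- (u * y ^+ 2 / 2)).
have mf : measurable_fun setT f.
  apply: measurable_funM => //; apply: measurableT_comp => //.
  apply: measurableT_comp => //; apply: measurable_funM => //.
  by apply: measurable_funM => //; exact: measurable_funX.
have f0 y : 0 <= f y by rewrite mulr_ge0 ?expR_ge0// ltW.
apply: (@le_trans _ _ (\int[P]_w (f (X w))%:E)%E).
  apply: (@le_probability_integral _ (f \o X)) => //.
  - by rewrite -[Y in measurable Y]setTI; exact: (mX measurableT _ mA).
  - exact: measurableT_comp.
  - by move=> w; exact: f0.
  - move=> w /= xX; rewrite /f.
    set y := - _.
    have yE : y = (X w) ^+ 2 / (4 * v) by rewrite /y /u sv; field; rewrite gt_eqF.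
    have y0 : x ^+ 2 / (4 * v) <= y.
      rewrite yE ler_pM2r ?invr_gt0 ?mulr_gt0//.
      by rewrite -[X in _ <= X]real_normK ?num_real// lerXn2r ?nnegrE// ltW.
    have yy : 0 < x ^+ 2 / (4 * v) by rewrite divr_gt0 ?exprn_gt0// mulr_gt0.
    apply: (@le_trans _ _ (k * ((x ^+ 2 / (4 * v)) ^+ m / m`!%:R))).
      have mf0 : m`!%:R != 0 :> R by rewrite pnatr_eq0 gtn_eqF// fact_gt0.
      have -> : k * ((x ^+ 2 / (4 * v)) ^+ m / m`!%:R) =
          (4 * v / x ^+ 2 * (x ^+ 2 / (4 * v))) ^+ m.
        by rewrite /k [in RHS]exprMn; field.
      rewrite (_ : 4 * v / x ^+ 2 * _ = 1); last by field; rewrite !gt_eqF.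
      by rewrite expr1n.
    rewrite ler_wpM2l ?(ltW k0)//.
    apply: (@le_trans _ _ (expR (x ^+ 2 / (4 * v)))); last by rewrite ler_expR.
    case: m @k {k0 f mf f0} => [|m] k.
      by rewrite expr0 fact0 mulr1n divr1 (le_trans _ (expR_ge1Dx _))// lerDl ltW.
    by apply: le_trans (expR_ge1Dxn m (ltW yy)); rewrite lerDr.
rewrite (integral_gaussian mX lawX s0 mf).
have us : u * s ^+ 2 = - 2^-1 by rewrite /u; field.
under eq_integral do rewrite /f -mulrA EFinM.
rewrite integralZl//; last first.
  apply/integrableP; split.
    apply/measurable_EFinP; apply: measurable_funM; last exact: measurable_normal_pdf.
    apply: measurableT_comp => //.
    apply: measurableT_comp => //; apply: measurable_funM => //.
    by apply: measurable_funM => //; exact: measurable_funX.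
  under eq_integral do rewrite gee0_abs ?lee_fin
    ?(mulr_ge0 (expR_ge0 _) (normal_pdf_ge0 _ _ _))//.
  by rewrite integral_expR_sqr_normal_pdf ?ltry// us; lra.
rewrite integral_expR_sqr_normal_pdf// us; last by lra.
have -> : 1 + - 2^-1 = 2^-1 :> R by field.
rewrite sqrtrV// invrK -EFinM lee_fin /k.
by rewrite mulrC mulrA.
Qed.

(** A Gaussian process only provides some parameters m and s for each combination; the first two
    moments identify m = 0 and s^2 = v. *)
Lemma centered_gaussian_of_moments (X : Omega -> R) (m s v : R) :
  measurable_fun setT X ->
  (forall A, measurable A -> P [set w | A (X w)] = gaussian_law m s A) ->
  (\int[P]_w (X w)%:E = 0)%E -> (\int[P]_w ((X w) ^+ 2)%:E = v%:E)%E ->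
  centered_gaussian X v.
Proof.
move=> mX lawX EX VX; split => //.
have m0 : m = 0.
  have [s0|s0] := eqVneq s 0.
    have := integral_gaussian0 mX lawX s0 (@measurable_id _ _ setT).
    by rewrite EX => -[].
  have := integral_gaussian mX lawX s0 (@measurable_id _ _ setT).
  rewrite EX.
  have -> : (\int[leb]_x (id x * normal_pdf m s x)%:E =
    \int[leb]_x (((x - m) * normal_pdf m s x)%:E + (m * normal_pdf m s x)%:E))%E.
    apply: eq_integral => x _; rewrite -EFinD; congr _%:E; rewrite /=; ring.
  have im : leb.-integrable setT (fun x => (m * normal_pdf m s x)%:E).
    apply: (@integrableZl _ _ _ leb setT measurableT m
      (fun x => (normal_pdf m s x)%:E)).
    exact: integrable_normal_pdf.
  rewrite integralD//; last exact: integrable_lin_normal_pdf.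
  rewrite integral_lin_normal_pdf// add0e.
  under eq_integral do rewrite EFinM.
  rewrite integralZl//; last exact: integrable_normal_pdf.
  by rewrite integral_normal_pdf mule1 => -[].
rewrite m0 in lawX.
exists s => //.
have [s0|s0] := eqVneq s 0.
  have := integral_gaussian0 mX lawX s0 (exprn_measurable 2).
  by rewrite VX s0 => -[->].
have := integral_gaussian mX lawX s0 (exprn_measurable 2).
by rewrite VX integral_sqr_normal_pdf// => -[].
Qed.

End gaussian_law.

(** * Small-ball probabilities of independent Gaussian variables *)

Section small_ball.
Context {R : realType} {dO : measure_display} {Omega : measurableType dO}.
Variable P : probability Omega R.
Notation leb := (@lebesgue_measure R).

(* Integrating the hypothesis against the normal density in [z] turns the
   cosine of [z X] into a Gaussian weight: [exp (- s^2 x^2 / 2)] is the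
   characteristic function of the normal law of variance [s^2]. *)
Lemma integral_gaussian_weight (W X Y : Omega -> R) (C v s : R) :
  s != 0 -> 0 <= v ->
  measurable_fun setT W -> measurable_fun setT X -> measurable_fun setT Y ->
  (forall w, `|W w| <= 1) ->
  (forall z, \int[P]_w (W w * cos (z * X w + Y w))%:E =
    (C * expR (- (v * z ^+ 2 / 2)))%:E)%E ->
  (\int[P]_w (W w * expR (- (s ^+ 2 * (X w) ^+ 2 / 2)) * cos (Y w))%:E =
   (C / Num.sqrt (1 + v * s ^+ 2))%:E)%E.
Proof.
move=> s0 v0 mW mX mY W1 H.
have vs : -1 < v * s ^+ 2 by rewrite (lt_le_trans (ltrN10 _))// mulr_ge0// sqr_ge0.
pose f (wz : Omega * R) : R :=
  W wz.1 * cos (Y wz.1) * (cos (X wz.1 * wz.2) * normal_pdf 0 s wz.2).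
have mc (d : measure_display) (T : measurableType d) (g : T -> R) :
    measurable_fun setT g -> measurable_fun setT (fun x => cos (g x)).
  move=> mg; exact: measurableT_comp measurable_cos mg.
have mf : measurable_fun setT f.
  apply: measurable_funM.
    apply: measurable_funM; first exact: measurableT_comp.
    by apply: mc; exact: measurableT_comp.
  apply: measurable_funM.
    apply: mc; apply: measurable_funM; last exact: measurable_snd.
    exact: measurableT_comp.
  apply: measurableT_comp; last exact: measurable_snd.
  exact: measurable_normal_pdf.
have f1 w z : `|f (w, z)| <= normal_pdf 0 s z.
  rewrite /f /= !normrM (ger0_norm (normal_pdf_ge0 _ _ _)) mulrA ler_piMl//.
    exact: normal_pdf_ge0.
  by rewrite !mulr_ile1// ?mulr_ge0// ler_norml cos_geN1 cos_le1.
have mf' : measurable_fun setT (EFin \o f) by exact/measurable_EFinP.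
have intf : (P \x leb)%E.-integrable setT (EFin \o f).
  apply/integrable12ltyP => //=.
  apply: (@le_lt_trans _ _ (\int[P]_w (cst 1 w))%E); last first.
    by rewrite integral_cst//= probability_setT mule1 ltry.
  apply: ge0_le_integral => //=.
  - by move=> w _; exact: integral_ge0.
  - apply: (@measurable_fun_fubini_tonelli_F _ _ _ _ _ leb (abse \o (EFin \o f))) => //.
      exact: measurableT_comp.
    by move=> x; exact: abse_ge0.
  - move=> w _; rewrite -(integral_normal_pdf 0 s).
    apply: ge0_le_integral => //=.
    + apply/measurable_EFinP.
      apply: (measurableT_comp (normr_measurable (R := R) (D := setT))).
      exact: (measurableT_comp mf (pair1_measurable w)).
    + by apply/measurable_EFinP; exact: measurable_normal_pdf.
    + by move=> z _; rewrite lee_fin.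
transitivity (\int[P]_w \int[leb]_z (f (w, z))%:E)%E.
  apply: eq_integral => w _.
  rewrite /f/=.
  under [RHS]eq_integral do rewrite EFinM.
  rewrite integralZl//; last exact: integrable_cos.
  by rewrite integral_cos_normal_pdf// -EFinM mulrAC.
rewrite (Fubini intf).
transitivity (\int[leb]_z (C%:E * (expR (- (v * z ^+ 2 / 2)) * normal_pdf 0 s z)%:E))%E.
  apply: eq_integral => z _.
  have iW (u : R) : P.-integrable setT (fun w => (W w * cos (u * X w + Y w))%:E).
    apply: (@le_integrable _ _ _ P setT measurableT _ (cst 1)%E).
    - apply/measurable_EFinP; apply: measurable_funM => //; apply: mc.
      by apply: measurable_funD => //; exact: measurable_funM.
    - move=> w _ /=; rewrite lee_fin normr1 normrM mulr_ile1//.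
      by rewrite ler_norml cos_geN1 cos_le1.
    - exact: finite_measure_integrable_cst.
  (* The product cos(zX) cos(Y) is half the sum of cos(zX + Y) and cos(-zX + Y), so the hypothesis
     applies at z and at -z. *)
  transitivity (\int[P]_w ((2^-1 * normal_pdf 0 s z)%:E *
      ((W w * cos (z * X w + Y w))%:E + (W w * cos (- z * X w + Y w))%:E)))%E.
    apply: eq_integral => w _; rewrite -EFinD -EFinM /f/=; congr EFin.
    rewrite mulNr (addrC (- _)) !cosD !cosN !sinN (mulrC z); by field.
  rewrite (integralZl measurableT (integrableD measurableT (iW z) (iW (- z)))).
  rewrite integralD//.
  rewrite !H sqrrN -EFinD -!EFinM; congr EFin; by field.
rewrite integralZl//.
  by rewrite integral_expR_sqr_normal_pdf// -EFinM.
apply: (@integrable_bounded_normal_pdf _ s _ 1).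
  apply: measurableT_comp => //.
  apply: measurableT_comp => //; apply: measurable_funM => //.
  by apply: measurable_funM => //; exact: measurable_funX.
move=> x; rewrite ger0_norm ?expR_ge0// -expR0 ler_expR oppr_le0.
by rewrite divr_ge0// mulr_ge0// sqr_ge0.
Qed.

(* The hypothesis says that the [X i] are independent of variance [v], through
   the characteristic function of the vector. The cosines are replaced one
   variable at a time by the weights [exp (- X_i^2 / 2 e^2)], each of which is
   at least [exp (- 1 / 2)] when [|X_i| <= e]. *)
Lemma gaussian_small_ball (K : nat) (X : nat -> Omega -> R) (v e : R) :
  0 < v -> 0 < e -> (forall i, measurable_fun setT (X i)) ->
  (forall b : nat -> R, \int[P]_w (cos (\sum_(0 <= i < K) b i * X i w))%:E =
    (expR (- (v * (\sum_(0 <= i < K) b i ^+ 2) / 2)))%:E)%E ->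
  (P [set w | forall i, (i < K)%N -> (`|X i w| <= e)%R] <=
   ((expR (1 / 2) * (e / Num.sqrt v)) ^+ K)%:E)%E.
Proof.
move=> v0 e0 mX H.
pose s := e^-1.
have s0 : s != 0 by rewrite invr_neq0// gt_eqF.
pose k := (Num.sqrt (1 + v * s ^+ 2))^-1.
pose g i w := expR (- (s ^+ 2 * (X i w) ^+ 2 / 2)).
have g0 i w : 0 <= g i w by exact: expR_ge0.
have g1 i w : g i w <= 1.
  by rewrite -expR0 ler_expR oppr_le0 divr_ge0// mulr_ge0 ?sqr_ge0.
have mg i : measurable_fun setT (g i).
  apply: measurableT_comp => //.
  apply: measurableT_comp => //; apply: measurable_funM => //.
  by apply: measurable_funM => //; exact: measurable_funX.
have mS J (b : nat -> R) :
    measurable_fun setT (fun w => \sum_(J <= i < K) b i * X i w).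
  by apply: measurable_sum => i; exact: measurable_funM.
have mG J : measurable_fun setT (fun w => \prod_(0 <= i < J) g i w).
  by apply: measurable_prod => i _; exact: mg.
(* After J steps the first J variables carry weights and the other K - J still appear in the cosine,
   with arbitrary coefficients. *)
have main J : (J <= K)%N -> forall b : nat -> R,
    (\int[P]_w ((\prod_(0 <= i < J) g i w) *
       cos (\sum_(J <= i < K) b i * X i w))%:E =
    (k ^+ J * expR (- (v * (\sum_(J <= i < K) b i ^+ 2) / 2)))%:E)%E.
  elim: J => [_ b|J IH JK b].
    by rewrite expr0 mul1r -H; apply: eq_integral => w _; rewrite big_nil mul1r.
  have G1 w : `|\prod_(0 <= i < J) g i w| <= 1.
    rewrite ger0_norm; last by apply: prodr_ge0 => i _.
    apply: (@le_trans _ _ (\prod_(0 <= i < J) 1)); last by rewrite big1.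
    by apply: ler_prod => i _; rewrite g0 g1.
  have := @integral_gaussian_weight (fun w => \prod_(0 <= i < J) g i w) (X J)
    (fun w => \sum_(J.+1 <= i < K) b i * X i w)
    (k ^+ J * expR (- (v * (\sum_(J.+1 <= i < K) b i ^+ 2) / 2))) v s s0 (ltW v0)
    (mG J) (mX J) (mS _ b) G1.
  move=> h; transitivity (\int[P]_w ((\prod_(0 <= i < J) g i w) * g J w *
    cos (\sum_(J.+1 <= i < K) b i * X i w))%:E)%E.
    by apply: eq_integral => w _; rewrite big_nat_recr.
  rewrite h => [|z].
    by rewrite -/k exprSr mulrAC.
  (* Leaving the coefficient of [X J] free in the induction hypothesis yields the family of
     identities in z that [integral_gaussian_weight] requires. *)
  pose b' i := if i == J then z else b i.
  have bS (F : nat -> R -> R) : \sum_(J <= i < K) F i (b' i) =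
      F J z + \sum_(J.+1 <= i < K) F i (b i).
    rewrite big_ltn// /b' eqxx; congr (_ + _).
    by apply: eq_big_nat => i /andP[Ji _]; rewrite gtn_eqF.
  have := IH (ltnW JK) b'.
  rewrite (bS (fun _ x => x ^+ 2)).
  under eq_integral => w _ do rewrite (bS (fun i x => x * X i w)).
  move=> ->; congr EFin.
  by rewrite -[RHS]mulrA -expRD; congr (_ * expR _); field.
have mA : measurable [set w | forall i, (i < K)%N -> (`|X i w| <= e)%R].
  have -> : [set w | forall i, (i < K)%N -> (`|X i w| <= e)%R] =
      \bigcap_(i in [set i | (i < K)%N]) [set w | (`|X i w| <= e)%R].
    by apply/seteqP; split => w /=.
  apply: fin_bigcap_measurable => [|i _]; first exact: finite_II.
  rewrite -[Y in measurable Y]setTI.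
  rewrite (_ : [set w | _] = (fun w => `|X i w|) @^-1` `]-oo, e]%classic).
    apply: (measurableT_comp (normr_measurable (R := R) (D := setT))) => //.
  by apply/seteqP; split => w /=; rewrite in_itv.
apply: (@le_trans _ _ (\int[P]_w (expR (1 / 2) ^+ K * \prod_(0 <= i < K) g i w)%:E)%E).
  apply: le_probability_integral => //.
  - by apply: measurable_funM => //; exact: mG.
  - by move=> w; rewrite mulr_ge0 ?exprn_ge0 ?expR_ge0// prodr_ge0.
  - move=> w wA.
    have -> : expR (1 / 2) ^+ K = \prod_(0 <= i < K) expR (1 / 2) :> R.
      by rewrite prodr_const_nat subn0.
    rewrite -big_split/= big_nat; apply: (big_ind (fun x => 1 <= x)) => //.
      by move=> x y x1 y1; rewrite -[1]mulr1 ler_pM.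
    move=> i /andP[_ iK]; rewrite /g -expRD.
    apply: (le_trans _ (expR_ge1Dx _)); rewrite lerDl.
    rewrite -mulrBl divr_ge0// subr_ge0 /s -exprMn.
    have := wA i iK => Xe; rewrite -[leRHS](expr1n _ 2).
    rewrite -[leLHS]real_normK ?num_real// lerXn2r ?nnegrE//.
    by rewrite normrM gtr0_norm ?invr_gt0// ler_pdivrMl// mulr1.
under eq_integral do rewrite EFinM.
have e0K : (\int[P]_w (\prod_(0 <= i < K) g i w)%:E = (k ^+ K)%:E)%E.
  have := main K (leqnn K) (fun=> 0); rewrite big_geq// mulr0 mul0r oppr0 expR0 mulr1 => <-.
  by apply: eq_integral => w _; rewrite [in X in cos X]big_geq// cos0 mulr1.
rewrite ge0_integralZl//; last 2 first.
- by apply/measurable_EFinP; exact: mG.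
- by move=> w _; rewrite lee_fin prodr_ge0.
rewrite e0K -EFinM lee_fin -exprMn lerXn2r ?nnegrE ?mulr_ge0 ?expR_ge0
  ?divr_ge0 ?invr_ge0 ?sqrtr_ge0 ?(ltW e0)//.
(* What remains is (1 + v / e^2)^(-1/2) <= e / sqrt v, obtained by dropping the 1. *)
rewrite ler_wpM2l ?expR_ge0// /k -[e]invrK -/s -invfM.
rewrite lef_pV2 ?posrE ?mulr_gt0 ?sqrtr_gt0 ?invr_gt0//; last first.
  by rewrite ltr_wpDr// mulr_ge0 ?sqr_ge0// ltW.
have -> : s * Num.sqrt v = Num.sqrt (v * s ^+ 2).
  by rewrite sqrtrM ?ltW// sqrtr_sqr gtr0_norm ?invr_gt0// mulrC.
by rewrite ler_wsqrtr// lerDr.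
Qed.

End small_ball.

(** * Half-cylinders and the variance of increments *)

Section sphere_measurability.
Context {R : realType} {d : nat}.

Lemma continuous_sphere_val : continuous (set_val : sphere_top R d -> 'rV[R]_d.+1).
Proof. exact: initial_continuous. Qed.

Lemma measurable_sphere_continuous (f : sphere_top R d -> R) :
  continuous f -> measurable_fun setT (f : sphere R d -> R).
Proof.
move=> cf; apply: (measurability _ (RGenOpens.measurableE R)).
move=> _ [_ [a [b ->] <-]]; rewrite setTI.
apply: sub_sigma_algebra.
by apply: open_comp; [move=> + _; exact: cf|exact: interval_open].
Qed.

Lemma measurable_sphere_val (i : 'I_d.+1) :
  measurable_fun setT (fun s : sphere R d => sphere_val s ord0 i).
Proof.
apply: (measurable_sphere_continuous (f := fun s : sphere_top R d => set_val s ord0 i)).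
move=> s; apply: (cvg_comp _ (fun M : 'rV[R]_d.+1 => M ord0 i) (@continuous_sphere_val s)).
exact: coord_continuous.
Qed.

Lemma measurable_antipode : measurable_fun setT (@antipode R d).
Proof.
apply: (@measurability _ _ _ (sphere R d) _ _ (@open (sphere_top R d))) => //.
move=> _ [A oA <-]; rewrite setTI.
apply: sub_sigma_algebra.
case: oA => W oW <-; exists (-%R @^-1` W) => //.
by apply: open_comp => // x _; exact: opp_continuous.
Qed.

Lemma measurable_inner (t : 'rV[R]_d.+1) :
  measurable_fun setT (fun s : sphere R d => inner (sphere_val s) t).
Proof.
apply: measurable_sum => i; apply: measurable_funM => //.
exact: measurable_sphere_val.
Qed.
End sphere_measurability.

Section halfcylinder_geometry.
Context {R : realType} {d : nat}.
Notation leb := (@lebesgue_measure R).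
Local Notation S := (sphere R d).
Implicit Types (t u p e : 'rV[R]_d.+1) (s : S).

Lemma innerD s t u :
  inner (sphere_val s) (t + u) = inner (sphere_val s) t + inner (sphere_val s) u.
Proof. by rewrite /inner -big_split/=; apply: eq_bigr => i _; rewrite mxE mulrDr. Qed.

Lemma innerZ s (a : R) t :
  inner (sphere_val s) (a *: t) = a * inner (sphere_val s) t.
Proof. by rewrite /inner mulr_sumr; apply: eq_bigr => i _; rewrite mxE mulrCA. Qed.

Lemma innerN s t :
  inner (sphere_val s) (- t) = - inner (sphere_val s) t.
Proof. by rewrite /inner -sumrN; apply: eq_bigr => i _; rewrite mxE mulrN. Qed.

Lemma inner_antipode s t :
  inner (sphere_val (antipode s)) t = - inner (sphere_val s) t.
Proof. by rewrite /inner -sumrN; apply: eq_bigr => i _; rewrite mxE mulNr. Qed.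

Lemma inner_sphere_val s : inner (sphere_val s) (sphere_val s) = 1.
Proof.
have := sphere_valP s; rewrite /unit_sphere/= /enorm => s1.
have : 0 <= inner (sphere_val s) (sphere_val s).
  by apply: sumr_ge0 => i _; rewrite -expr2 sqr_ge0.
by move/sqr_sqrtr; rewrite s1 expr1n.
Qed.

Lemma le_coord_mx_norm t i : `|t ord0 i| <= `|t|.
Proof.
rewrite /Num.norm/= mx_normrE.
exact: (le_bigmax_cond _ (fun ij : 'I_1 * 'I_d.+1 => `|t ij.1 ij.2|) (j := (ord0, i))).
Qed.

Lemma coord_sphere_le1 s i : `|sphere_val s ord0 i| <= 1.
Proof.
have : `|sphere_val s ord0 i| ^+ 2 <= 1.
  rewrite real_normK ?num_real// -(inner_sphere_val s) /inner (bigD1 i)//= expr2.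
  by rewrite lerDl sumr_ge0// => j _; rewrite -expr2 sqr_ge0.
by rewrite expr_le1.
Qed.

(** The coordinates of s are at most 1 in absolute value; the factor [d.+1] counts them, the norm of
    t being the sup norm. *)
Lemma norm_inner_le s t : `|inner (sphere_val s) t| <= d.+1%:R * `|t|.
Proof.
apply: le_trans (ler_norm_sum _ _ _) _.
apply: (@le_trans _ _ (\sum_(i < d.+1) `|t|)).
  apply: ler_sum => i _; rewrite normrM -[leRHS]mul1r ler_pM//.
    exact: coord_sphere_le1.
  exact: le_coord_mx_norm.
by rewrite sumr_const card_ord mulr_natl.
Qed.

Lemma measurable_inner_snd t :
  measurable_fun setT (fun x : R * S => inner (sphere_val x.2) t).
Proof. exact: (measurableT_comp (measurable_inner t) measurable_snd). Qed.

Lemma measurable_Vset t : measurable (@Vset R d t).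
Proof.
have m1 := @measurable_fst _ _ (R : measurableType _) S.
apply: measurableI.
  rewrite -[X in measurable X]setTI /halfcyl.
  have -> : [set x : R * S | 0 < x.1] = fst @^-1` `]0, +oo[%classic.
    by apply/seteqP; split => x /=; rewrite in_itv/= andbT.
  exact: m1.
rewrite -[X in measurable X]setTI.
exact: (measurable_fun_ltr m1 (measurable_inner_snd t)).
Qed.

Lemma bounded_borel_Vset t : bounded_borel (@Vset R d t).
Proof.
split; [exact: measurable_Vset|by move=> x []|].
exists (d.+1%:R * `|t|) => x [_ /= /ltW xt]; apply: le_trans xt _.
exact: le_trans (ler_norm _) (norm_inner_le _ _).
Qed.

Lemma indic_VsetE t (r : R) s :
  \1_(Vset t) (r, s) = \1_(`]0, inner (sphere_val s) t[%classic) r :> R.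
Proof.
rewrite !indicE; congr (_%:R); congr nat_of_bool.
apply/idP/idP; rewrite !inE /Vset /halfcyl /= in_itv/=.
  by move=> [-> ->].
by move=> /andP[].
Qed.

Lemma integral_indic_Vset s t :
  (\int[leb]_r (\1_(Vset t) (r, s))%:E =
   (Num.max 0 (inner (sphere_val s) t))%:E)%E.
Proof.
under eq_integral do rewrite indic_VsetE.
rewrite integral_indic//= setIT lebesgue_measure_itv/= lte_fin.
by case: ltP => // _; rewrite sube0.
Qed.

(** Over the ray through s both slices are intervals starting at 0, hence nested: the squared
    difference of the indicators is the indicator of the longer minus that of the shorter. *)
Lemma integral_sqr_sub_indic_Vset s t u :
  (\int[leb]_r ((\1_(Vset t) (r, s) - \1_(Vset u) (r, s)) ^+ 2)%:E =
   `|Num.max 0 (inner (sphere_val s) t) -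
     Num.max 0 (inner (sphere_val s) u)|%:E)%E.
Proof.
wlog ut : t u / inner (sphere_val s) u <= inner (sphere_val s) t.
  move=> H; have [/H//|/ltW tu] := leP (inner (sphere_val s) u) (inner (sphere_val s) t).
  rewrite distrC -H//; apply: eq_integral => r _.
  by rewrite -sqrrN opprB.
have int_i v : leb.-integrable setT (fun r => (\1_(Vset v) (r, s) : R)%:E).
  apply/integrableP; split.
    apply/measurable_EFinP; under eq_fun do rewrite indic_VsetE.
    exact: measurable_indic.
  under eq_integral do rewrite gee0_abs ?lee_fin//.
  by rewrite integral_indic_Vset ltry.
transitivity (\int[leb]_r ((\1_(Vset t) (r, s))%:E - (\1_(Vset u) (r, s))%:E))%E.
  apply: eq_integral => r _; rewrite -EFinB; congr _%:E.
  rewrite !indic_VsetE !indicE !mem_setE !in_itv/=.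
  case: (ltP 0 r) => _ /=; last by rewrite subrr expr0n.
  case: (ltP r (inner (sphere_val s) u)) => ru.
    by rewrite (lt_le_trans ru ut) subrr expr0n.
  by case: (r < _); rewrite !subr0 ?expr1n ?expr0n.
rewrite integralB// !integral_indic_Vset -EFinB; congr EFin.
by rewrite ger0_norm// subr_ge0 ge_max le_max lexx/= le_max ut orbT.
Qed.

End halfcylinder_geometry.

(** For b <= a the positive part increases and the negative part decreases from b to a, so the
    absolute values add up to a - b. Applied to a ray and its antipode, this removes the positive
    parts. *)
Lemma normr_sub_max (R : realType) (a b : R) :
  `|Num.max 0 a - Num.max 0 b| + `|Num.max 0 (- a) - Num.max 0 (- b)| =
  `|a - b|.
Proof.
wlog ba : a b / b <= a.
  move=> H; have [/H//|/ltW/H] := leP b a.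
  by rewrite distrC [X in _ + X]distrC => ->; exact: distrC.
rewrite [RHS]ger0_norm ?subr_ge0//.
rewrite ger0_norm ?subr_ge0; last by rewrite ge_max !le_max lexx ba orbT.
rewrite ler0_norm ?subr_le0; last by rewrite ge_max !le_max lexx lerN2 ba orbT.
by case: (leP 0 a) => ?; case: (leP 0 b) => ?; case: (leP 0 (- a)) => ?;
  case: (leP 0 (- b)) => ?; lra.
Qed.

Section increment_variance.
Context {R : realType} {d : nat}.
Variable mu : {finite_measure set (sphere R d) -> \bar R}.
Hypothesis mu_sym : symmetric_measure mu.
Notation leb := (@lebesgue_measure R).
Local Notation S := (sphere R d).
Local Notation lm := (leb \x mu)%E.
Implicit Types (t u p e : 'rV[R]_d.+1) (s : S).

(** The value at t - u is the variance of the increment between t and u; the factor 1/2 comes from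
    averaging over s and -s. *)
Definition increment_variance t : R :=
  fine (\int[mu]_s `|inner (sphere_val s) t|%:E) / 2.

Lemma integral_antipode (f : S -> \bar R) : measurable_fun setT f ->
  (forall s, 0 <= f s)%E -> (\int[mu]_s f (antipode s) = \int[mu]_s f s)%E.
Proof.
move=> mf f0.
have := @ge0_integral_pushforward _ _ _ _ _ _ (@measurable_antipode R d) mu _ _
  measurableT mf (fun s _ => f0 s).
rewrite preimage_setT => <-.
apply: eq_measure_integral => [|mA A mA' _]; first exact: measurable_antipode.
exact: (mu_sym mA').
Qed.

Lemma measurable_inner_EFin t :
  measurable_fun setT (fun s : S => `|inner (sphere_val s) t|%:E).
Proof.
apply/measurable_EFinP.
apply: (measurableT_comp (normr_measurable (R := R) (D := setT))).
exact: measurable_inner.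
Qed.

Lemma integral_inner_le t :
  (\int[mu]_s `|inner (sphere_val s) t|%:E <=
   ((d.+1%:R * `|t|) * fine (mu setT))%:E)%E.
Proof.
apply: (@le_trans _ _ (\int[mu]_s (cst (d.+1%:R * `|t|)%:E s))%E).
  apply: ge0_le_integral => //=.
  - exact: measurable_inner_EFin.
  - by move=> s _; rewrite lee_fin norm_inner_le.
by rewrite integral_cst// [leRHS]EFinM fineK ?fin_num_measure.
Qed.

Lemma increment_varianceE t :
  (\int[mu]_s `|inner (sphere_val s) t|%:E = (2 * increment_variance t)%:E)%E.
Proof.
rewrite /increment_variance mulrCA divff ?mulr1 ?fineK//.
rewrite ge0_fin_numE ?integral_ge0//.
exact: le_lt_trans (integral_inner_le t) (ltry _).
Qed.

Lemma increment_variance_ge0 t : 0 <= increment_variance t.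
Proof. by rewrite divr_ge0// fine_ge0// integral_ge0. Qed.

Lemma increment_variance_le t :
  increment_variance t <= (d.+1%:R * fine (mu setT)) * `|t|.
Proof.
have := integral_inner_le t; rewrite increment_varianceE lee_fin => h.
have := increment_variance_ge0 t; rewrite mulrAC; move: h; set x := _ * _ * _; lra.
Qed.

(** Along a fixed direction the variance is thus proportional to the step, which is the source of
    the exponent 1/2. *)
Lemma increment_varianceZ (a : R) t : 0 <= a ->
  increment_variance (a *: t) = a * increment_variance t.
Proof.
move=> a0; rewrite /increment_variance.
under eq_integral do rewrite innerZ normrM (ger0_norm a0) EFinM.
rewrite ge0_integralZl//; last exact: measurable_inner_EFin.
rewrite increment_varianceE -EFinM/=; by ring.
Qed.

Lemma measurable_indic_Vset t : measurable_fun setT (\1_(@Vset R d t) : R * S -> R).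
Proof. by apply: measurable_indic; exact: measurable_Vset. Qed.

(** Tonelli's theorem integrates the radial variable first, leaving a difference of positive parts;
    adding its image under the antipode, which has the same integral by symmetry, gives twice the
    result. *)
Lemma integral_sqr_increment t u :
  (\int[lm]_x ((\1_(Vset t) x - \1_(Vset u) x) ^+ 2)%:E =
   (increment_variance (t - u))%:E)%E.
Proof.
have mf : measurable_fun setT (fun x : R * S =>
    ((\1_(Vset t) x - \1_(Vset u) x) ^+ 2 : R)%:E).
  apply/measurable_EFinP; apply: measurable_funX.
  by apply: measurable_funB; exact: measurable_indic_Vset.
rewrite fubini_tonelli2//; last by move=> x; rewrite lee_fin sqr_ge0.
rewrite /fubini_G/=.
under eq_integral do rewrite integral_sqr_sub_indic_Vset.
pose g s := `|Num.max 0 (inner (sphere_val s) t) - Num.max 0 (inner (sphere_val s) u)|.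
have mg : measurable_fun setT (fun s => (g s)%:E).
  apply/measurable_EFinP.
  apply: (measurableT_comp (normr_measurable (R := R) (D := setT))).
  by apply: measurable_funB; apply: measurable_maxr => //; exact: measurable_inner.
have gN s : g s + g (antipode s) = `|inner (sphere_val s) (t - u)|.
  rewrite /g !inner_antipode innerD innerN.
  set a := inner _ t; set b := inner _ u.
  exact: normr_sub_max.
have : (\int[mu]_s (g s)%:E + \int[mu]_s (g s)%:E = (2 * increment_variance (t - u))%:E)%E.
  have g0 s : (0 <= (g s)%:E)%E by rewrite lee_fin normr_ge0.
  rewrite -[X in (_ + X)%E](integral_antipode mg g0) -ge0_integralD//.
  - by under eq_integral do rewrite -EFinD gN; rewrite increment_varianceE.
  - exact: (measurableT_comp mg (@measurable_antipode R d)).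
set x := (\int[mu]_s _)%E => h.
have x0 : (0 <= x)%E by apply: integral_ge0 => s _; rewrite lee_fin normr_ge0.
by case: x x0 h => //= x _ [h]; congr EFin; lra.
Qed.

End increment_variance.

Section increment_variance_pos.
Context {R : realType} {d : nat}.
Variable mu : {finite_measure set (sphere R d) -> \bar R}.
Local Notation S := (sphere R d).

Lemma inner_delta (s : S) (i : 'I_d.+1) :
  inner (sphere_val s) (delta_mx ord0 i) = sphere_val s ord0 i.
Proof.
rewrite /inner (bigD1 i)//= big1 => [|j /negbTE ji].
  by rewrite mxE !eqxx mulr1 addr0.
by rewrite mxE ji andbF mulr0.
Qed.

(** Otherwise every |s_i| would have integral 0, whereas 1 = sum of s_i^2 <= sum of |s_i| on the
    sphere, so the total mass would vanish. *)
Lemma increment_variance_delta_gt0 : mu [set: S] <> 0%E ->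
  exists i : 'I_d.+1, 0 < increment_variance mu (delta_mx ord0 i).
Proof.
move=> mu0; apply/not_existsP => H; apply: mu0; apply/eqP.
rewrite eq_le measure_ge0 andbT.
have H0 i : (\int[mu]_s `|sphere_val s ord0 i|%:E = 0)%E.
  have := increment_varianceE mu (delta_mx ord0 i).
  under eq_integral do rewrite inner_delta.
  move=> ->; have := H i; move/negP; rewrite -leNgt => iv.
  have : increment_variance mu (delta_mx ord0 i) = 0.
    by apply/eqP; rewrite eq_le iv increment_variance_ge0.
  by move=> ->; rewrite mulr0.
have m i : measurable_fun setT (fun s : S => `|sphere_val s ord0 i|%:E).
  apply: (eq_measurable_fun _ _ (measurable_inner_EFin (delta_mx ord0 i))) => s _.
  by rewrite inner_delta.
rewrite -[leLHS](_ : \int[mu]_s cst 1 s = _)%E; last by rewrite integral_cst// mul1e.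
apply: (@le_trans _ _ (\int[mu]_s (\sum_(i < d.+1) `|sphere_val s ord0 i|%:E))%E).
  apply: ge0_le_integral => //.
  - exact: emeasurable_sum.
  - move=> s _ /=; rewrite sumEFin lee_fin -(inner_sphere_val s).
    apply: ler_sum => i _; rewrite -expr2 -real_normK ?num_real//.
    by rewrite expr2 ler_piMr// coord_sphere_le1.
by rewrite ge0_integral_sum// big1.
Qed.

End increment_variance_pos.

(** * Laws of the increments *)

Section white_noise_increments.
Context {R : realType} {d : nat}.
Variable mu : {finite_measure set (sphere R d) -> \bar R}.
Hypothesis mu_sym : symmetric_measure mu.
Context {dO : measure_display} {Omega : measurableType dO}.
Variable P : probability Omega R.
Variable G : set (R * sphere R d) -> {RV P >-> R}.
Hypothesis G_noise : white_noise mu G.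
Notation leb := (@lebesgue_measure R).
Local Notation S := (sphere R d).
Local Notation lm := (leb \x mu)%E.
Implicit Types (t u p e : 'rV[R]_d.+1).
Local Notation ind t x := (\1_(@Vset R d t) x : R).

Lemma Vset0 : Vset (0 : 'rV[R]_d.+1) = set0.
Proof.
apply/seteqP; split => // x [/= x0]; have := innerZ x.2 0 (0 : 'rV[R]_d.+1).
rewrite scale0r mul0r => ->; rewrite /halfcyl /= in x0.
by move=> /(lt_trans x0); rewrite ltxx.
Qed.

(** The product is at most the indicator of V_t, which is the squared increment between t and 0
    because V_0 is empty. *)
Lemma integrable_indic_Vset t u : lm.-integrable setT (fun x => (ind t x * ind u x)%:E).
Proof.
have m := @measurable_indic_Vset R d.
apply: (@le_integrable _ _ _ lm setT measurableT _
  (fun x => ((ind t x - ind 0 x) ^+ 2)%:E)).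
- by apply/measurable_EFinP; apply: measurable_funM; exact: m.
- move=> x _ /=; rewrite lee_fin Vset0 indic0 subr0 ger0_norm// ger0_norm ?sqr_ge0// expr2.
  by rewrite !indicE; do 2 case: (_ \in _); rewrite ?mulr1 ?mulr0.
- apply/integrableP; split.
    apply/measurable_EFinP; apply: measurable_funX.
    by apply: measurable_funB; exact: m.
  under eq_integral do rewrite gee0_abs ?lee_fin ?sqr_ge0//.
  by rewrite integral_sqr_increment// ltry.
Qed.

(** For t = u the covariance is the integral of a nonnegative function and is finite, which gives
    square integrability; mixed products are then dominated by the sum of the squares. *)
Lemma noise_mul t u :
  P.-integrable setT (fun w => (G (Vset t) w * G (Vset u) w)%:E) /\
  (\int[P]_w (G (Vset t) w * G (Vset u) w)%:E =
   \int[lm]_x (ind t x * ind u x)%:E)%E.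
Proof.
have [_ _ cov] := G_noise.
have covE v v' : (\int[P]_w (G (Vset v) w * G (Vset v') w)%:E =
    \int[lm]_x (ind v x * ind v' x)%:E)%E.
  have := cov _ _ (bounded_borel_Vset v) (bounded_borel_Vset v').
  rewrite expectation_def => ->.
  rewrite integral_mkcond; apply: eq_integral => x _.
  rewrite patchE indicI; case: ifPn => // /negP xh.
  rewrite /= !indicE memNset ?mul0r// => -[hx _].
  by apply: xh; rewrite inE.
split; last exact: covE.
have sq v : P.-integrable setT (fun w => (G (Vset v) w * G (Vset v) w)%:E).
  apply/integrableP; split; first by apply/measurable_EFinP; exact: measurable_funM.
  under eq_integral do rewrite gee0_abs ?lee_fin -?expr2 ?sqr_ge0//.
  under eq_integral do rewrite expr2.
  rewrite covE.
  have /integrableP[_] := integrable_indic_Vset v v.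
  by under eq_integral do rewrite gee0_abs ?lee_fin ?mulr_ge0//.
apply: (@le_integrable _ _ _ P setT measurableT _
  (fun w => (G (Vset t) w * G (Vset t) w)%:E + (G (Vset u) w * G (Vset u) w)%:E)%E).
- by apply/measurable_EFinP; exact: measurable_funM.
- move=> w _; rewrite -EFinD /= lee_fin normrM [leRHS]ger0_norm.
    rewrite -!expr2 -(real_normK (num_real (G (Vset t) w))).
    rewrite -(real_normK (num_real (G (Vset u) w))).
    set a := `|_|; set b := `|_|.
    have a0 : 0 <= a by exact: normr_ge0.
    have b0 : 0 <= b by exact: normr_ge0.
    by have := sqr_ge0 (a - b); nra.
  by rewrite addr_ge0// -expr2 sqr_ge0.
- exact: integrableD.
Qed.

Lemma integrable_noise t : P.-integrable setT (fun w => (G (Vset t) w)%:E).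
Proof.
apply: (@le_integrable _ _ _ P setT measurableT _
  (fun w => (cst 1 w)%:E + (G (Vset t) w * G (Vset t) w)%:E)%E).
- exact/measurable_EFinP.
- move=> w _; rewrite -EFinD /= lee_fin [leRHS]ger0_norm.
    rewrite -!expr2 -(real_normK (num_real (G (Vset t) w))).
    set a := `|_|.
    have a0 : 0 <= a by exact: normr_ge0.
    by have := sqr_ge0 (a - 1); nra.
  by rewrite addr_ge0// -expr2 sqr_ge0.
- apply: integrableD => //; last by have [] := noise_mul t t.
  exact: finite_measure_integrable_cst.
Qed.

Local Notation comb l x := (\sum_(p <- l) p.1 * (\1_(@Vset R d p.2) x : R)).
Local Notation ncomb l w := (\sum_(p <- l) p.1 * G (@Vset R d p.2) w).
Implicit Types l k : seq (R * 'rV[R]_d.+1).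

(** The noise is an isometry from the span of the indicators into L^2(P). A combination is a list of
    pairs (coefficient, point), and the identity extends bilinearly by induction on both lists. *)
Lemma noise_comb_mul l k :
  [/\ P.-integrable setT (fun w => (ncomb l w * ncomb k w)%:E),
     lm.-integrable setT (fun x => (comb l x * comb k x)%:E) &
   (\int[P]_w (ncomb l w * ncomb k w)%:E =
    \int[lm]_x (comb l x * comb k x)%:E)%E].
Proof.
have bil (f f' : Omega -> R) (g g' : R * S -> R) (a : R) :
  [/\ P.-integrable setT (EFin \o f), lm.-integrable setT (EFin \o g) &
     (\int[P]_w (f w)%:E = \int[lm]_x (g x)%:E)%E] ->
  [/\ P.-integrable setT (EFin \o f'), lm.-integrable setT (EFin \o g') &
     (\int[P]_w (f' w)%:E = \int[lm]_x (g' x)%:E)%E] ->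
  [/\ P.-integrable setT (fun w => (a * f w + f' w)%:E),
      lm.-integrable setT (fun x => (a * g x + g' x)%:E) &
     (\int[P]_w (a * f w + f' w)%:E = \int[lm]_x (a * g x + g' x)%:E)%E].
  move=> [if_ ig fg] [if' ig' fg'].
  have iaf : P.-integrable setT (fun w => a%:E * (f w)%:E)%E by exact: integrableZl.
  have iag : lm.-integrable setT (fun w => a%:E * (g w)%:E)%E by exact: integrableZl.
  split.
  - exact: (integrableD measurableT iaf if').
  - exact: (integrableD measurableT iag ig').
  - have := integralD measurableT iaf if'; have := integralD measurableT iag ig'.
    rewrite (integralZl measurableT if_) (integralZl measurableT ig).
    by rewrite fg fg' => <- <-.
have zero : [/\ P.-integrable setT (fun=> (0 : R)%:E),
     lm.-integrable setT (fun=> (0 : R)%:E) &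
   (\int[P]_w (0 : R)%:E = \int[lm]_x (0 : R)%:E)%E].
  by split; [exact: integrable0|exact: integrable0|rewrite !integral0].
have eqT (f f' : Omega -> R) (g g' : R * S -> R) : f = f' -> g = g' ->
  [/\ P.-integrable setT (EFin \o f), lm.-integrable setT (EFin \o g) &
     (\int[P]_w (f w)%:E = \int[lm]_x (g x)%:E)%E] ->
  [/\ P.-integrable setT (EFin \o f'), lm.-integrable setT (EFin \o g') &
     (\int[P]_w (f' w)%:E = \int[lm]_x (g' x)%:E)%E] by move=> -> ->.
elim: l => [|[a t] l IH].
  apply: (eqT (fun=> 0) _ (fun=> 0)) => //.
  - by apply/funext => w; rewrite big_nil mul0r.
  - by apply/funext => w; rewrite big_nil mul0r.
have tk : [/\ P.-integrable setT (fun w => (G (Vset t) w * ncomb k w)%:E),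
     lm.-integrable setT (fun x => (ind t x * comb k x)%:E) &
   (\int[P]_w (G (Vset t) w * ncomb k w)%:E =
    \int[lm]_x (ind t x * comb k x)%:E)%E].
  elim: k {IH} => [|[b u] k IH].
    apply: (eqT (fun=> 0) _ (fun=> 0)) => //.
    - by apply/funext => w; rewrite big_nil mulr0.
    - by apply/funext => w; rewrite big_nil mulr0.
  have [n1 n2] := noise_mul t u.
  have := bil _ _ _ _ b (And3 n1 (integrable_indic_Vset t u) n2) IH.
  apply: eqT; apply/funext => w; rewrite big_cons /=; ring.
have := bil _ _ _ _ a tk IH.
by apply: eqT; apply/funext => w; rewrite big_cons /=; ring.
Qed.

Lemma noise_comb_mean l :
  P.-integrable setT (fun w => (ncomb l w)%:E) /\ (\int[P]_w (ncomb l w)%:E = 0)%E.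
Proof.
have [_ cent _] := G_noise.
elim: l => [|[a t] l [IH1 IH2]].
  under eq_integral do rewrite big_nil.
  split; last by rewrite integral0.
  apply: (eq_integrable _ (cst 0%E)) => // [w _|]; last exact: integrable0.
  by rewrite big_nil.
have h1 : P.-integrable setT (fun w => a%:E * (G (Vset t) w)%:E)%E.
  by apply: integrableZl => //; exact: integrable_noise.
have h2 := integrableD measurableT h1 IH1.
split.
  by apply: eq_integrable h2 => // w _; rewrite big_cons.
under eq_integral do rewrite big_cons EFinD EFinM.
rewrite (integralD measurableT h1 IH1) IH2 adde0.
rewrite integralZl//; last exact: integrable_noise.
have := cent _ (bounded_borel_Vset t); rewrite expectation_def => ->.
by rewrite mule0.
Qed.

(** Laws of combinations are hereby reduced to integrals of combinations of indicators. *)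
Lemma noise_comb_gaussian l (v : R) :
  (\int[lm]_x (comb l x ^+ 2)%:E = v%:E)%E ->
  centered_gaussian P (fun w => ncomb l w) v.
Proof.
move=> lv; have [gp _ _] := G_noise.
have [m [s law]] := gp (size l) (fun i => Vset (tnth (in_tuple l) i).2)
  (fun i => (tnth (in_tuple l) i).1) (fun i => bounded_borel_Vset _).
apply: (@centered_gaussian_of_moments _ _ _ _ _ m s).
- by apply: measurable_sum => p; exact: measurable_funM.
- move=> A mA; rewrite -law//; congr (P _).
  by apply/seteqP; split => w /=; rewrite (big_tnth _ _ l).
- by have [] := noise_comb_mean l.
- have [_ _] := noise_comb_mul l l; under eq_integral do rewrite -expr2.
  by move=> ->; under eq_integral do rewrite -expr2.
Qed.

End white_noise_increments.

Lemma centered_gaussian_ae (R : realType) (dO : measure_display)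
    (Omega : measurableType dO) (P : probability Omega R) (X Y : Omega -> R) v :
  centered_gaussian P X v -> measurable_fun setT Y ->
  {ae P, forall w, Y w = X w} -> centered_gaussian P Y v.
Proof.
move=> [mX [s sv law]] mY YX; split => //; exists s => // A mA.
rewrite -law//.
have mXA : measurable [set w | A (X w)].
  by rewrite -[Z in measurable Z]setTI; exact: (mX measurableT _ mA).
have mYA : measurable [set w | A (Y w)].
  by rewrite -[Z in measurable Z]setTI; exact: (mY measurableT _ mA).
rewrite -[X in P X]setIT -integral_indic// -[X in _ = P X]setIT -integral_indic//.
apply: ae_eq_integral => //.
- exact/measurable_EFinP/measurable_indic.
- exact/measurable_EFinP/measurable_indic.
- apply: filterS YX => w YXw _; rewrite !indicE.
  rewrite (_ : (w \in [set w | A (X w)]) = (w \in [set w | A (Y w)]))//.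
  by apply/idP/idP; rewrite !inE /= YXw.
Qed.

Section field_increments.
Context {R : realType} {d : nat}.
Variable mu : {finite_measure set (sphere R d) -> \bar R}.
Hypothesis mu_sym : symmetric_measure mu.
Context {dO : measure_display} {Omega : measurableType dO}.
Variable P : probability Omega R.
Variable G : set (R * sphere R d) -> {RV P >-> R}.
Hypothesis G_noise : white_noise mu G.
Variable B : 'rV[R]_d.+1 -> {RV P >-> R}.
Hypothesis B_mod : modification (fun t => G (Vset t)) B.
Notation leb := (@lebesgue_measure R).
Local Notation S := (sphere R d).
Local Notation lm := (leb \x mu)%E.
Implicit Types (t u p e : 'rV[R]_d.+1).
Local Notation ind t x := (\1_(@Vset R d t) x : R).
Local Notation comb l x := (\sum_(p <- l) p.1 * (\1_(@Vset R d p.2) x : R)).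
Implicit Types l k : seq (R * 'rV[R]_d.+1).

Lemma field_comb_gaussian l (v : R) :
  (\int[lm]_x (comb l x ^+ 2)%:E = v%:E)%E ->
  centered_gaussian P (fun w => \sum_(p <- l) p.1 * B p.2 w) v.
Proof.
move=> /(noise_comb_gaussian mu_sym G_noise) /centered_gaussian_ae; apply.
  by apply: measurable_sum => p; exact: measurable_funM.
elim: l => [|[a t] l IH].
  by apply: aeW => w; rewrite !big_nil.
apply: filterS2 (B_mod t) IH => w Bt IH.
by rewrite !big_cons Bt IH.
Qed.

Lemma field_increment_gaussian t u :
  centered_gaussian P (fun w => B t w - B u w) (increment_variance mu (t - u)).
Proof.
pose l : seq (R * 'rV[R]_d.+1) := [:: (1, t); (-1, u)].
have lE (F : 'rV[R]_d.+1 -> R) : \sum_(z <- l) z.1 * F z.2 = F t - F u.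
  by rewrite !big_cons big_nil /= mul1r mulN1r addr0.
have -> : (fun w => B t w - B u w) = (fun w => \sum_(z <- l) z.1 * B z.2 w).
  by apply/funext => w; rewrite (lE (fun t => B t w)).
apply: field_comb_gaussian.
rewrite -integral_sqr_increment//; apply: eq_integral => x _.
by rewrite (lE (fun t => ind t x)).
Qed.

Section line.
Variables (p e : 'rV[R]_d.+1) (h : R).
Hypothesis h0 : 0 < h.
Local Notation q j := (p + (j%:R * h) *: e).
Local Notation dlt j x := (ind (q j.+1) x - ind (q j) x).

(** The inner product of s with the j-th point of the line is affine in j; the sign of its slope
    decides between the two cases. *)
Lemma indic_Vset_line_monotone (x : R * S) :
  {homo (fun j => ind (q j) x) : i j / (i <= j)%N >-> i <= j} \/
  {homo (fun j => ind (q j) x) : i j / (i <= j)%N >-> j <= i}.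
Proof.
have le_ind t u : inner (sphere_val x.2) t <= inner (sphere_val x.2) u ->
    ind t x <= ind u x.
  move=> tu; rewrite !indicE ler_nat.
  have [xt|//] := boolP (x \in Vset t).
  suff -> : x \in Vset u by [].
  rewrite inE; move: xt; rewrite inE => -[x0 /= xt]; split => //=.
  exact: lt_le_trans xt tu.
have [ep|en] := leP 0 (inner (sphere_val x.2) e); [left|right] => i j ij;
  apply: le_ind; rewrite !innerD !innerZ lerD2l.
  by rewrite ler_wpM2r// ler_wpM2r ?(ltW h0)// ler_nat.
by rewrite ler_wnM2r ?(ltW en)// ler_wpM2r ?(ltW h0)// ler_nat.
Qed.

(** A monotone sequence with values 0 and 1 jumps at most once. *)
Lemma indic_Vset_line_orthogonal (x : R * S) (i j : nat) : (i < j)%N ->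
  dlt i x * dlt j x = 0.
Proof.
move=> ij.
have i01 t : ind t x = 0 \/ ind t x = 1 by rewrite indicE; case: (_ \in _); [right|left].
have := indic_Vset_line_monotone x => -[] mono.
- have := mono _ _ (leqnSn i); have := mono _ _ ij; have := mono _ _ (leqnSn j).
  by case: (i01 (q i)) => ->; case: (i01 (q i.+1)) => ->;
    case: (i01 (q j)) => ->; case: (i01 (q j.+1)) => ->; lra.
- have := mono _ _ (leqnSn i); have := mono _ _ ij; have := mono _ _ (leqnSn j).
  by case: (i01 (q i)) => ->; case: (i01 (q i.+1)) => ->;
    case: (i01 (q j)) => ->; case: (i01 (q j.+1)) => ->; lra.
Qed.

Lemma sqr_sum_line (b : nat -> R) (K : nat) (x : R * S) :
  (\sum_(0 <= i < K) b i * dlt i x) ^+ 2 =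
  \sum_(0 <= i < K) b i ^+ 2 * dlt i x ^+ 2.
Proof.
elim: K => [|K IH]; first by rewrite !big_nil expr0n.
rewrite !big_nat_recr//= sqrrD IH exprMn; congr (_ + _).
rewrite -[RHS]addr0; congr (_ + _).
rewrite mulr_suml big_nat_cond big1 ?mul0rn// => i /andP[/andP[_ iK] _].
by rewrite mulrACA indic_Vset_line_orthogonal// mulr0.
Qed.

Lemma integral_sqr_line (b : nat -> R) (K : nat) :
  (\int[lm]_x ((\sum_(0 <= i < K) b i * dlt i x) ^+ 2)%:E =
   (increment_variance mu e * h * \sum_(0 <= i < K) b i ^+ 2)%:E)%E.
Proof.
under eq_integral do rewrite sqr_sum_line -sumEFin.
rewrite ge0_integral_sum//; last 2 first.
- move=> i; apply/measurable_EFinP; apply: measurable_funM => //.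
  apply: measurable_funX; apply: measurable_funB; exact: measurable_indic_Vset.
- by move=> i x _; rewrite lee_fin mulr_ge0// sqr_ge0.
rewrite mulr_sumr -sumEFin; apply: eq_bigr => i _.
under eq_integral do rewrite EFinM.
rewrite ge0_integralZl//; last 3 first.
- apply/measurable_EFinP; apply: measurable_funX.
  by apply: measurable_funB; exact: measurable_indic_Vset.
- by move=> x _; rewrite lee_fin sqr_ge0.
- by rewrite lee_fin sqr_ge0.
rewrite integral_sqr_increment// -EFinM mulrC; congr (_ * _)%:E.
rewrite opprD addrACA subrr add0r -scalerBl -mulrBl -natrB// subSnn mul1r.
by rewrite increment_varianceZ ?ltW// mulrC.
Qed.

(** The joint characteristic function of consecutive increments is that of independent Gaussian
    variables with variance [increment_variance mu e * h], as [gaussian_small_ball] requires. *)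
Lemma field_line_cos (b : nat -> R) (K : nat) :
  (\int[P]_w (cos (\sum_(0 <= i < K) b i * (B (q i.+1) w - B (q i) w)))%:E =
  (expR (- (increment_variance mu e * h * (\sum_(0 <= i < K) b i ^+ 2) / 2)))%:E)%E.
Proof.
pose l := flatten [seq [:: (b i, q i.+1); (- b i, q i)] | i <- index_iota 0 K].
have lE (F : 'rV[R]_d.+1 -> R) : \sum_(z <- l) z.1 * F z.2 =
    \sum_(0 <= i < K) b i * (F (q i.+1) - F (q i)).
  rewrite /l big_flatten big_map; apply: eq_bigr => i _.
  by rewrite !big_cons big_nil /= addr0 mulNr mulrBr.
have := @field_comb_gaussian l (increment_variance mu e * h * \sum_(0 <= i < K) b i ^+ 2).
have H : (\int[lm]_x (comb l x ^+ 2)%:E =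
    (increment_variance mu e * h * \sum_(0 <= i < K) b i ^+ 2)%:E)%E.
  rewrite -integral_sqr_line; apply: eq_integral => x _.
  by rewrite (lE (fun t => ind t x)).
move=> /(_ H)/(@centered_gaussian_cos _ _ _ _ _ _ 1); rewrite expr1n mulr1 => <-.
by apply: eq_integral => w _; rewrite mul1r (lE (fun t => B t w)).
Qed.

End line.
End field_increments.

(** * Dyadic grids and the modulus of continuity *)

Section borel_cantelli_geometric.
Context {R : realType} {dO : measure_display} {Omega : measurableType dO}.
Variable P : probability Omega R.

Lemma borel_cantelli_geometric (E : nat -> set Omega) (c r : R) :
  0 <= c -> 0 <= r -> r < 1 -> (forall n, measurable (E n)) ->
  (forall n, (P (E n) <= (c * r ^+ n)%:E)%E) ->
  {ae P, forall w, exists n0, forall n, (n0 <= n)%N -> ~ E n w}.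
Proof.
move=> c0 r0 r1 mE EP.
exists (lim_sup_set E); split.
- apply: bigcap_measurable; first by exists 0%N.
  by move=> n _; exact: bigcup_measurable.
- apply: lim_sup_set_cvg0 => //.
  apply: (@le_lt_trans _ _ (c / (1 - r))%:E); last exact: ltry.
  apply: lime_le.
    by apply: is_cvg_nneseries => n _ _; exact: measure_ge0.
  apply: nearW => n.
  apply: (@le_trans _ _ (\sum_(0 <= i < n) (c * r ^+ i)%:E)%E).
    by apply: lee_sum => i _; exact: EP.
  rewrite sumEFin lee_fin.
  have rn1 : r != 1 by rewrite lt_eqF.
  have := geometric_seriesE c rn1.
  move=> /(congr1 (fun f => f n)); rewrite /series/= => ->.
  rewrite ler_pM2r ?invr_gt0 ?subr_gt0// ler_piMr// lerBlDr lerDl.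
  exact: exprn_ge0.
- move=> w /= /forallNP Hw n _.
  have := Hw n => /existsNP[m] /not_implyP[nm] /contrapT Em.
  by exists m.
Qed.

Lemma finite_union_bound (K : finType) (A : K -> set Omega) (M : R) :
  (forall k, measurable (A k)) -> (forall k, (P (A k) <= M%:E)%E) ->
  measurable [set w | exists k, A k w] /\
  (P [set w | exists k, A k w] <= (#|K|%:R * M)%:E)%E.
Proof.
move=> mA AM.
have key (s : seq K) : measurable [set w | exists2 k, k \in s & A k w] /\
    (P [set w | exists2 k, k \in s & A k w] <= ((size s)%:R * M)%:E)%E.
  elim: s => [|k s [mIH IH]].
    rewrite (_ : [set w | _] = set0); first by rewrite measure0 mul0r.
    by apply/seteqP; split => // w [].
  rewrite (_ : [set w | _] = A k `|` [set w | exists2 k, k \in s & A k w]).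
    split; first exact: measurableU.
    apply: le_trans (measureU2 _ _ _) _ => //.
    by rewrite /= -natr1 mulrDl mul1r addrC EFinD leeD.
  apply/seteqP; split => w /=.
    by move=> [j]; rewrite inE => /predU1P[->|js] Aj; [left|right; exists j].
  move=> [Ak|[j js Aj]]; first by exists k => //; rewrite mem_head.
  by exists j => //; rewrite inE js orbT.
have [] := key (enum K); rewrite -cardE.
rewrite (_ : [set w | exists2 k, _ & _] = [set w | exists k, A k w])//.
apply/seteqP; split => w /= [k]; first by exists k.
by move=> Ak; exists k => //; rewrite mem_enum.
Qed.

End borel_cantelli_geometric.

Section dyadic_grid.
Context {R : realType} {d : nat}.
Implicit Types (t u : 'rV[R]_d.+1) (M n : nat).

(** The number of multiples of 2^-n in [-M, M], both ends included. *)
Definition grid_size M n : nat := ((2 * M) * 2 ^ n).+1.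

Definition grid_point M n (k : {ffun 'I_d.+1 -> 'I_(grid_size M n)}) : 'rV[R]_d.+1 :=
  \row_i ((k i)%:R / 2 ^+ n - M%:R).

(** Rounds each coordinate down to a multiple of 2^-n; meaningful when the sup norm of t is at most
    M. *)
Definition grid_index M n t : {ffun 'I_d.+1 -> 'I_(grid_size M n)} :=
  [ffun i => inord (Num.truncn (2 ^+ n * (t ord0 i + M%:R)))].

Definition grid_approx M n t := grid_point (grid_index M n t).

Lemma mx_norm_le (x : 'rV[R]_d.+1) (e : R) : 0 <= e ->
  (`|x| <= e) <-> (forall i, `|x ord0 i| <= e).
Proof.
move=> e0; split=> [xe i|H].
  exact: le_trans (le_coord_mx_norm x i) xe.
rewrite /Num.norm/= mx_normrE; apply: bigmax_le => // -[i j] _ /=.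
by rewrite ord1.
Qed.

Lemma grid_approx_le M n t : `|t| <= M%:R -> `|t - grid_approx M n t| <= (2 ^+ n)^-1.
Proof.
move=> tM; have e0 : 0 <= (2 ^+ n)^-1 :> R by rewrite invr_ge0 exprn_ge0.
apply/mx_norm_le => // i; rewrite !mxE ffunE.
have p0 : 0 < 2 ^+ n :> R by rewrite exprn_gt0.
have ti : `|t ord0 i| <= M%:R by apply: le_trans (le_coord_mx_norm t i) tM.
move: ti; rewrite ler_norml => /andP[t1 t2].
set y := 2 ^+ n * _.
have y0 : 0 <= y by rewrite mulr_ge0 ?exprn_ge0// -lerBlDr sub0r.
(* The index is in range, so [inord] does not return its default value. *)
have yM : (Num.truncn y <= (2 * M) * 2 ^ n)%N.
  have : y <= ((2 * M) * 2 ^ n)%:R.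
    by rewrite !natrM natrX /y mulrC ler_wpM2r ?exprn_ge0//; lra.
  move=> h; rewrite -(ler_nat R); apply: le_trans h.
  by have /andP[] := truncn_itv y0.
rewrite inordK ?ltnS//.
have /andP[l u] := truncn_itv y0.
set z := (Num.truncn y)%:R in l u *.
have -> : t ord0 i - (z / 2 ^+ n - M%:R) = (y - z) / 2 ^+ n.
  by rewrite /y; field; rewrite gt_eqF.
rewrite ger0_norm; last by rewrite divr_ge0 ?subr_ge0// ltW.
rewrite ler_pdivrMr// mulVf ?gt_eqF//.
by rewrite lerBlDr addrC -[_ + 1]/(z + 1) natr1 ltW.
Qed.

Lemma card_grid M n :
  (#|{: {ffun 'I_d.+1 -> 'I_(grid_size M n)}}|%:R : R) <=
  (2 * M%:R + 1) ^+ d.+1 * (2 ^+ d.+1) ^+ n.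
Proof.
rewrite card_ffun !card_ord natrX -exprM mulnC exprM -exprMn.
rewrite lerXn2r ?nnegrE ?mulr_ge0 ?addr_ge0 ?mulr_ge0 ?exprn_ge0//.
rewrite /grid_size -addn1 natrD !natrM natrX [leRHS]mulrDl mul1r lerD2l.
by rewrite exprn_ege1// ler1n.
Qed.

End dyadic_grid.

Lemma expr_le_eps (R : realType) (z e : R) : 0 <= z < 1 -> 0 < e ->
  exists n0, forall n, (n0 <= n)%N -> z ^+ n <= e.
Proof.
move=> /andP[z0 z1] e0.
have z1' : `|z| < 1 by rewrite ger0_norm.
have /cvgrPdist_le /(_ e e0) [n0 _ H] := cvg_expr z1'.
exists n0 => n n0n; have := H n n0n.
by rewrite sub0r normrN ger0_norm// exprn_ge0.
Qed.

(** An injection of [D] into the natural numbers reduces this to a countable intersection of almost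
    sure events. *)
Lemma ae_countable (R : realType) (dO : measure_display)
    (Omega : measurableType dO) (P : probability Omega R) (T : Type)
    (D : set T) (Q : T -> Omega -> Prop) :
  countable D -> (forall t, D t -> {ae P, forall w, Q t w}) ->
  {ae P, forall w, forall t, D t -> Q t w}.
Proof.
move=> /countable_injP[f finj] H.
have : {ae P, forall w, forall n : nat, forall t, D t -> f t = n -> Q t w}.
  apply: ae_foralln => n.
  have [[t [Dt ft]]|no] := pselect (exists t, D t /\ f t = n).
    apply: filterS (H t Dt) => w Qw u Du fu.
    by have -> : u = t by apply: finj; rewrite ?inE// fu ft.
  by apply: aeW => w t Dt ft; exfalso; apply: no; exists t.
by apply: filterS => w Hw t Dt; exact: Hw Dt erefl.
Qed.

(* [q] plays the role of [2 `^ (- g)] for an exponent [g], and the condition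
   [1 < 2 * q ^+ 2] means [g < 1 / 2]. *)
Section kolmogorov_chentsov.
Context {R : realType} {d : nat}.
Context {dO : measure_display} {Omega : measurableType dO}.
Variable P : probability Omega R.
Variable B : 'rV[R]_d.+1 -> {RV P >-> R}.
Variable C0 : R.
Hypothesis C0_ge0 : 0 <= C0.
Hypothesis B_inc : forall t u, exists2 v, v <= C0 * `|t - u| &
  centered_gaussian P (fun w => B t w - B u w) v.
Implicit Types (t u : 'rV[R]_d.+1) (M n : nat).

Variable q : R.
Hypothesis q01 : 0 < q < 1.
Hypothesis q2 : 1 < 2 * q ^+ 2.
Let q0 : 0 < q. Proof. by case/andP : q01. Qed.
Let q1 : q < 1. Proof. by case/andP : q01. Qed.

(** At level n the variances are of order 2^-n and the squared threshold is q^(2n): their ratio is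
    of order theta^n. *)
Let theta := (2 * q ^+ 2)^-1.

Let theta01 : 0 <= theta < 1.
Proof.
by rewrite invr_ge0 invf_lt1 ?q2 ?andbT ?(lt_trans ltr01 q2)// mulr_ge0// sqr_ge0.
Qed.

Let tail_event n t u : set Omega := [set w | q ^+ n < `|B t w - B u w|].

Let measurable_tail_event n t u : measurable (tail_event n t u).
Proof.
rewrite /tail_event -[X in measurable X]setTI.
have -> : [set w | q ^+ n < `|B t w - B u w|] =
    (fun w => `|B t w - B u w|) @^-1` `]q ^+ n, +oo[%classic.
  by apply/seteqP; split => w /=; rewrite in_itv/= andbT.
have m : measurable_fun setT (fun w => `|B t w - B u w|).
  apply: (measurableT_comp (normr_measurable (R := R) (D := setT))).
  exact: measurable_funB.
exact: m.
Qed.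

(** The variance v is at most 2 C0 / 2^n, so the ratio 4 v / q^(2n) in the tail bound is at most 8
    C0 theta^n. *)
Let tail_event_le n (m : nat) t u : `|t - u| <= 2 / 2 ^+ n ->
  (P (tail_event n t u) <=
   (Num.sqrt 2 * m`!%:R * (8 * C0) ^+ m * (theta ^+ m) ^+ n)%:E)%E.
Proof.
move=> tu; have [v vC g] := B_inc t u.
have v0 : 0 <= v by case: g => _ [s <- _]; exact: sqr_ge0.
apply: le_trans (centered_gaussian_tail m g (exprn_gt0 n q0)) _.
rewrite lee_fin -[leRHS]mulrA ler_wpM2l ?mulr_ge0//.
rewrite exprAC -exprMn lerXn2r ?nnegrE//.
- by rewrite divr_ge0 ?sqr_ge0// mulr_ge0.
- by rewrite mulr_ge0 ?mulr_ge0// exprn_ge0//; case/andP : theta01.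
have qn : 0 < (q ^+ n) ^+ 2 by rewrite exprn_gt0// exprn_gt0.
rewrite ler_pdivrMr// /theta exprVn exprMn exprAC.
have -> : 8 * C0 * (2 ^+ n * (q ^+ n) ^+ 2)^-1 * (q ^+ n) ^+ 2 = 4 * (C0 * (2 / 2 ^+ n)).
  by field; rewrite !gt_eqF ?exprn_gt0.
by rewrite ler_pM2l//; apply: le_trans vC _; rewrite ler_wpM2l.
Qed.

Lemma grid_increments_le M :
  {ae P, forall w, exists n0, forall n, (n0 <= n)%N -> forall k l,
    `|@grid_point R d M n k - @grid_point R d M n.+1 l| <= 2 / 2 ^+ n ->
    `|B (grid_point k) w - B (grid_point l) w| <= q ^+ n}.
Proof.
(* The moment [m] is arbitrary, so the union bound may run over all pairs of
   grid points instead of the neighbouring ones only. *)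
pose K n : finType := ({ffun 'I_d.+1 -> 'I_(grid_size M n)} *
  {ffun 'I_d.+1 -> 'I_(grid_size M n.+1)})%type.
pose A n (kl : K n) :=
  if `|@grid_point R d M n kl.1 - @grid_point R d M n.+1 kl.2| <= 2 / 2 ^+ n
  then tail_event n (grid_point kl.1) (grid_point kl.2) else set0.
pose b : R := (2 ^+ d.+1) ^+ 2.
have b0 : 0 < b by rewrite exprn_gt0// exprn_gt0.
(* The number of pairs of grid points grows like b^n; this m gives b theta^m <= 1/2, so the
   probabilities are summable. *)
have [m mP] := expr_le_eps theta01 (divr_gt0 (ltr0Sn R 0) (mulr_gt0 (ltr0Sn R 1) b0)).
have {}mP := mP m (leqnn m).
pose c1 : R := (2 * M%:R + 1) ^+ d.+1.
have c10 : 0 <= c1 by rewrite exprn_ge0// addr_ge0// mulr_ge0.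
pose a := Num.sqrt 2 * m`!%:R * (8 * C0) ^+ m.
have a0 : 0 <= a by rewrite !mulr_ge0// exprn_ge0// mulr_ge0.
have th0 : 0 <= theta by case/andP : theta01.
have mA n kl : measurable (A n kl) by rewrite /A; case: ifP.
have AP n kl : (P (A n kl) <= (a * (theta ^+ m) ^+ n)%:E)%E.
  rewrite /A; case: ifPn => [h|_]; first exact: tail_event_le.
  by rewrite measure0 lee_fin mulr_ge0// exprn_ge0// exprn_ge0.
have E n := finite_union_bound (mA n) (AP n).
have := @borel_cantelli_geometric R _ _ P (fun n => [set w | exists k, A n k w])
  (c1 ^+ 2 * 2 ^+ d.+1 * a) (b * theta ^+ m).
have bt : b * theta ^+ m <= 1 / 2.
  apply: le_trans (ler_wpM2l (ltW b0) mP) _.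
  by rewrite le_eqVlt; apply/orP; left; apply/eqP; field; rewrite gt_eqF.
move=> /(_ _ _ _ (fun n => (E n).1)) => bc.
apply: filterS (bc _ _ _ _).
- move=> w [n0 H]; exists n0 => n n0n k l kl.
  rewrite leNgt; apply/negP => lt; apply: (H n n0n).
  by exists (k, l); rewrite /A/= kl.
- by rewrite mulr_ge0// mulr_ge0 ?sqr_ge0// exprn_ge0.
- by rewrite mulr_ge0 ?(ltW b0)// exprn_ge0.
- by apply: le_lt_trans bt _; lra.
- move=> n; apply: le_trans (E n).2 _.
  rewrite lee_fin card_prod natrM.
  apply: (@le_trans _ _ ((c1 * (2 ^+ d.+1) ^+ n) *
    (c1 * (2 ^+ d.+1) ^+ n.+1) * (a * (theta ^+ m) ^+ n))).
    rewrite ler_wpM2r//; first by rewrite mulr_ge0// exprn_ge0// exprn_ge0.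
    by rewrite ler_pM//; exact: card_grid.
  rewrite /b; set x := 2 ^+ d.+1; set y := theta ^+ m.
  have -> : (x ^+ 2 * y) ^+ n = x ^+ n * x ^+ n * y ^+ n.
    by rewrite exprMn exprAC expr2.
  by rewrite (exprS x) le_eqVlt; apply/orP; left; apply/eqP; ring.
Qed.

(** Only one pair of points occurs at each level, so the tail bound with m = 1 is already
    summable. *)
Lemma grid_approx_cvg M t : `|t| <= M%:R ->
  {ae P, forall w, exists n0, forall n, (n0 <= n)%N ->
    `|B t w - B (grid_approx M n t) w| <= q ^+ n}.
Proof.
move=> tM.
have th0 : 0 <= theta by case/andP : theta01.
have := @borel_cantelli_geometric R _ _ P (fun n => tail_event n t (grid_approx M n t))
  (Num.sqrt 2 * 1`!%:R * (8 * C0) ^+ 1) (theta ^+ 1).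
move=> bc; apply: filterS (bc _ _ _ _ _).
- by move=> w [n0 H]; exists n0 => n /H /negP; rewrite -leNgt.
- by rewrite !mulr_ge0// exprn_ge0// mulr_ge0.
- by rewrite exprn_ge0.
- by rewrite expr1; case/andP : theta01.
- by [].
- move=> n; apply: tail_event_le.
  apply: le_trans (grid_approx_le n tM) _.
  by rewrite ler_peMl ?ler1n// invr_ge0 exprn_ge0.
Qed.

End kolmogorov_chentsov.

(** * Deterministic chaining along dyadic approximations *)

Section chaining.
Context {R : realType} {d : nat}.
Variables (f : 'rV[R]_d.+1 -> R) (q : R) (M n0 : nat).
Hypothesis q01 : 0 < q < 1.
Hypothesis f_grid : forall n, (n0 <= n)%N -> forall k l,
  `|@grid_point R d M n k - @grid_point R d M n.+1 l| <= 2 / 2 ^+ n ->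
  `|f (grid_point k) - f (grid_point l)| <= q ^+ n.
Implicit Types (t u : 'rV[R]_d.+1) (n : nat).

(** In units of 2^-n, the distance 1/2 and the rounding errors 1 and 1/2 add up to the 2 allowed in
    [f_grid]. The case t = u gives the links of a chain, the general case the bridge between two
    chains. *)
Lemma grid_approx_increment n t u : (n0 <= n)%N ->
  `|t| <= M%:R -> `|u| <= M%:R -> `|t - u| <= 2^-1 / 2 ^+ n ->
  `|f (grid_approx M n t) - f (grid_approx M n.+1 u)| <= q ^+ n.
Proof.
move=> n0n tM uM tu; apply: f_grid => //.
have -> : grid_point (grid_index M n t) - grid_point (grid_index M n.+1 u) =
    (t - u) + ((u - grid_approx M n.+1 u) - (t - grid_approx M n t)).
  rewrite /grid_approx; set a := grid_point _; set b := grid_point _.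
  by apply/rowP => i; rewrite !mxE; ring.
have h1 := grid_approx_le n tM; have h2 := grid_approx_le n.+1 uM.
apply: le_trans (ler_normD _ _) _; apply: le_trans (lerD tu (ler_normB _ _)) _.
apply: le_trans (lerD (lexx _) (lerD h2 h1)) _.
rewrite exprS invfM; set x := (2 ^+ n)^-1.
by rewrite le_eqVlt; apply/orP; left; apply/eqP; field.
Qed.

Lemma grid_approx_chain n m t : (n0 <= n)%N -> `|t| <= M%:R ->
  `|f (grid_approx M n t) - f (grid_approx M (n + m) t)| <= q ^+ n / (1 - q).
Proof.
move=> n0n tM; have /andP[q0 q1] := q01.
have q1' : 0 < 1 - q by rewrite subr_gt0.
(* The partial geometric sum is the bound that passes through the induction on m. *)
suff H : `|f (grid_approx M n t) - f (grid_approx M (n + m) t)| <=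
    q ^+ n * (1 - q ^+ m) / (1 - q).
  apply: le_trans H _; rewrite ler_pM2r ?invr_gt0//.
  by rewrite ler_piMr ?exprn_ge0 ?(ltW q0)// lerBlDr lerDl exprn_ge0// ltW.
elim: m => [|m IH]; first by rewrite addn0 !subrr mulr0 mul0r normr0.
rewrite -(subrK (f (grid_approx M (n + m) t)) (f (grid_approx M n t))) -addrA.
apply: le_trans (ler_normD _ _) _.
have step : `|f (grid_approx M (n + m) t) - f (grid_approx M (n + m.+1) t)| <= q ^+ (n + m).
  rewrite addnS; apply: grid_approx_increment => //.
    exact: leq_trans n0n (leq_addr _ _).
  by rewrite subrr normr0 mulr_ge0// invr_ge0 exprn_ge0.
apply: le_trans (lerD IH step) _.
rewrite exprD exprS; set x := q ^+ n; set y := q ^+ m.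
by rewrite le_eqVlt; apply/orP; left; apply/eqP; field; rewrite gt_eqF.
Qed.

Lemma chaining_le t u n : (n0 <= n)%N -> `|t| <= M%:R -> `|u| <= M%:R ->
  `|t - u| <= 2^-1 / 2 ^+ n ->
  (exists m0, forall m, (m0 <= m)%N -> `|f t - f (grid_approx M m t)| <= q ^+ m) ->
  (exists m0, forall m, (m0 <= m)%N -> `|f u - f (grid_approx M m u)| <= q ^+ m) ->
  `|f t - f u| <= (3 + 2 / (1 - q)) * q ^+ n.
Proof.
move=> n0n tM uM tu [m1 H1] [m2 H2]; have /andP[q0 q1] := q01.
pose m := maxn (maxn m1 m2) n.+1.
have nm : (n.+1 <= m)%N by rewrite leq_maxr.
have {H1} := H1 m (leq_trans (leq_maxl _ _) (leq_maxl _ _)).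
have {H2} := H2 m (leq_trans (leq_maxr _ _) (leq_maxl _ _)).
have := grid_approx_increment n0n tM uM tu.
have := grid_approx_chain (m - n) n0n tM; rewrite subnKC ?(ltnW nm)//.
have := grid_approx_chain (m - n.+1) (leqW n0n) uM; rewrite subnKC//.
set a1 := f (grid_approx M n t); set a2 := f (grid_approx M n.+1 u).
set a3 := f (grid_approx M m t); set a4 := f (grid_approx M m u).
move=> h1 h2 h3 h4 h5.
have qmn : q ^+ m <= q ^+ n by rewrite ler_wiXn2l ?(ltW q0) ?(ltW q1)// ltnW.
have qSn : q ^+ n.+1 <= q ^+ n by rewrite ler_wiXn2l ?(ltW q0) ?(ltW q1).
have q1' : 0 < (1 - q)^-1 by rewrite invr_gt0 subr_gt0.
have h1' : q ^+ n.+1 / (1 - q) <= q ^+ n / (1 - q) by rewrite ler_pM2r.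
(* The path goes from t down its chain to level n, across to level n + 1 of u, and up to u. The two
   ends and the bridge give the 3, the two chains the 2 / (1 - q). *)
have -> : f t - f u = (f t - a3) - (a1 - a3) + (a1 - a2) + (a2 - a4) - (f u - a4) by ring.
have := ler_normB ((f t - a3) - (a1 - a3) + (a1 - a2) + (a2 - a4)) (f u - a4).
have := ler_normD ((f t - a3) - (a1 - a3) + (a1 - a2)) (a2 - a4).
have := ler_normD ((f t - a3) - (a1 - a3)) (a1 - a2).
have := ler_normB (f t - a3) (a1 - a3).
have -> : (3 + 2 / (1 - q)) * q ^+ n = 3 * q ^+ n + 2 * (q ^+ n / (1 - q)).
  by rewrite mulrDl mulrAC -!mulrA.
by lra.
Qed.

End chaining.

Section kolmogorov_chentsov_field.
Context {R : realType} {d : nat}.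
Context {dO : measure_display} {Omega : measurableType dO}.
Variable P : probability Omega R.
Variable B : 'rV[R]_d.+1 -> {RV P >-> R}.
Variable C0 : R.
Hypothesis C0_ge0 : 0 <= C0.
Hypothesis B_inc : forall t u, exists2 v, v <= C0 * `|t - u| &
  centered_gaussian P (fun w => B t w - B u w) v.
Hypothesis B_sep : separable_field B.
Variable q : R.
Hypothesis q01 : 0 < q < 1.
Hypothesis q2 : 1 < 2 * q ^+ 2.

Lemma dense_meets (D : set 'rV[R]_d.+1) (t : 'rV[R]_d.+1) (e M : R) :
  dense D -> 0 < e -> `|t| < M -> exists v, [/\ D v, `|t - v| < e & `|v| < M].
Proof.
move=> dD e0 tM.
have e0' : 0 < Num.min e (M - `|t|) by rewrite lt_min e0 subr_gt0.
have : ball t (Num.min e (M - `|t|)) `&` D !=set0.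
  apply: dD; first by exists t; exact: ballxx.
  exact: ball_open.
move=> [v [tv Dv]]; exists v; move: tv; rewrite -ball_normE /ball_ /= lt_min => /andP[te tM'].
split => //; rewrite -(subrK t v); apply: le_lt_trans (ler_normD _ _) _.
by rewrite distrC -ltrBrDr.
Qed.

Lemma kolmogorov_chentsov M :
  {ae P, forall w, exists n0, forall n, (n0 <= n)%N -> forall t u,
    `|t| < M%:R -> `|u| < M%:R -> `|t - u| < 8^-1 / 2 ^+ n ->
    `|B t w - B u w| <= 2 * (3 + 2 / (1 - q)) * q ^+ n}.
Proof.
have [D [cD dD sep]] := B_sep.
have grid := grid_increments_le C0_ge0 B_inc q01 q2 M.
have pt : {ae P, forall w, forall t, D t -> `|t| <= M%:R ->
    exists n0, forall n, (n0 <= n)%N -> `|B t w - B (grid_approx M n t) w| <= q ^+ n}.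
  apply: ae_countable => // t Dt.
  have [tM|tM] := pselect (`|t| <= M%:R); last by apply: aeW => w /tM.
  by apply: filterS (grid_approx_cvg C0_ge0 B_inc q01 q2 tM) => w H _.
apply: filterS3 sep grid pt => w sepw [n0 gridw] ptw.
set C := 3 + 2 / (1 - q).
have dense_le n t u : (n0 <= n)%N -> D t -> D u -> `|t| <= M%:R -> `|u| <= M%:R ->
    `|t - u| <= 2^-1 / 2 ^+ n -> `|B t w - B u w| <= C * q ^+ n.
  move=> n0n Dt Du tM uM tu.
  exact: (chaining_le (f := fun t => B t w) q01 gridw n0n tM uM tu
    (ptw t Dt tM) (ptw u Du uM)).
exists n0 => n n0n.
have p0 : 0 < (2 ^+ n)^-1 :> R by rewrite invr_gt0 exprn_gt0.
(* With v fixed in [D], the bound is a closed condition on the value at u, so separability extends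
   it from the points of [D] in an open set to all points of that set. *)
have half_le v u : D v -> `|v| < M%:R -> `|u| < M%:R -> `|v - u| < 2^-1 / 2 ^+ n ->
    `|B v w - B u w| <= C * q ^+ n.
  move=> Dv vM uM vu.
  have := sepw (ball v (2^-1 / 2 ^+ n) `&` ball 0 M%:R)
    [set x | `|B v w - x| <= C * q ^+ n].
  apply.
  - by apply: openI; exact: ball_open.
  - have -> : [set x | `|B v w - x| <= C * q ^+ n] =
        closed_ball_ Num.norm (B v w) (C * q ^+ n) by [].
    exact: closed_closed_ball_.
  - move=> x []; rewrite -!ball_normE /ball_ /= sub0r normrN => vx xM Dx.
    by apply: dense_le => //; exact: ltW.
  - by rewrite -!ball_normE /ball_ /= sub0r normrN.
move=> t u tM uM tu.
have r0 : 0 < 8^-1 / 2 ^+ n :> R by rewrite mulr_gt0// invr_gt0.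
(* A point of [D] close to t serves as intermediary: 1/8 + 1/8 stays below 1/2, and the two
   comparisons give the factor 2. *)
have [v [Dv tv vM]] := dense_meets dD r0 tM.
have vu : `|v - u| < 2^-1 / 2 ^+ n.
  rewrite -(subrK t v) -addrA; apply: le_lt_trans (ler_normD _ _) _.
  rewrite (distrC v); move: tv tu; set x := (2 ^+ n)^-1 in p0 *; lra.
have vt : `|v - t| < 2^-1 / 2 ^+ n.
  rewrite (distrC v); move: tv; set x := (2 ^+ n)^-1 in p0 *; lra.
have h1 := half_le v u Dv vM uM vu; have h2 := half_le v t Dv vM tM vt.
have -> : B t w - B u w = (B v w - B u w) - (B v w - B t w) by ring.
apply: le_trans (ler_normB _ _) _; rewrite -mulrA; lra.
Qed.

End kolmogorov_chentsov_field.

(** * Roughness *)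

Section no_small_increments.
Context {R : realType} {d : nat}.
Context {dO : measure_display} {Omega : measurableType dO}.
Variable P : probability Omega R.
Variable B : 'rV[R]_d.+1 -> {RV P >-> R}.
Variables (e : 'rV[R]_d.+1) (c : R).
Hypothesis c0 : 0 < c.
Hypothesis B_line : forall p (h : R) (b : nat -> R) (K : nat), 0 < h ->
  (\int[P]_w (cos (\sum_(0 <= i < K) b i *
     (B (p + (i.+1%:R * h) *: e) w - B (p + (i%:R * h) *: e) w)))%:E =
  (expR (- (c * h * (\sum_(0 <= i < K) b i ^+ 2) / 2)))%:E)%E.

(* [r] plays the role of [2 `^ (- g)] with [g > 1 / 2]. *)
Lemma no_small_increments (r : R) : 0 < r -> 2 * r ^+ 2 < 1 ->
  exists K : nat, forall M : nat, {ae P, forall w, exists n0,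
    forall n, (n0 <= n)%N -> forall k, exists2 i, (i < K)%N &
      r ^+ n < `|B (@grid_point R d M n k + (i.+1%:R * (2 ^+ n)^-1) *: e) w -
                 B (grid_point k + (i%:R * (2 ^+ n)^-1) *: e) w|}.
Proof.
move=> r0 r2.
pose x : R := 2 ^+ d.+1.
have x0 : 0 < x by rewrite exprn_gt0.
(* The threshold r^n over the deviation sqrt(c 2^-n) is sg^n / sqrt c, and 2 r^2 < 1 means sg <
   1. *)
pose sg := r * Num.sqrt 2.
have sg0 : 0 < sg by rewrite mulr_gt0// sqrtr_gt0.
have sg1 : sg < 1.
  by rewrite -(expr_lt1 (n := 2)) ?ltW// exprMn sqr_sqrtr// mulrC.
have sg01 : 0 <= sg < 1 by rewrite ltW.
(* The grid has of the order of x^n points, and K independent increments make x sg^K <= 1/2; this K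
   does not depend on M. *)
have [K KP] := expr_le_eps sg01 (divr_gt0 (ltr0Sn R 0) (mulr_gt0 (ltr0Sn R 1) x0)).
have {}KP := KP K (leqnn K).
exists K => M.
pose X n k i w := B (@grid_point R d M n k + (i.+1%:R * (2 ^+ n)^-1) *: e) w -
                 B (grid_point k + (i%:R * (2 ^+ n)^-1) *: e) w.
have mX n k i : measurable_fun setT (X n k i) by exact: measurable_funB.
pose A n k : set Omega := [set w | forall i, (i < K)%N -> `|X n k i w| <= r ^+ n].
have p0 n : 0 < (2 ^+ n)^-1 :> R by rewrite invr_gt0 exprn_gt0.
have mA n k : measurable (A n k).
  have -> : A n k = \bigcap_(i in [set i | (i < K)%N]) [set w | `|X n k i w| <= r ^+ n].
    by apply/seteqP; split => w /=.
  apply: fin_bigcap_measurable => [|i _]; first exact: finite_II.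
  rewrite -[Y in measurable Y]setTI.
  rewrite (_ : [set w | _] = (fun w => `|X n k i w|) @^-1` `]-oo, r ^+ n]%classic).
    by apply: (measurableT_comp (normr_measurable (R := R) (D := setT))).
  by apply/seteqP; split => w /=; rewrite in_itv.
pose a := (expR (1 / 2) / Num.sqrt c) ^+ K.
have a0 : 0 <= a by rewrite exprn_ge0// divr_ge0 ?expR_ge0 ?sqrtr_ge0.
have AP n k : (P (A n k) <= (a * (sg ^+ K) ^+ n)%:E)%E.
  have := @gaussian_small_ball _ _ _ P K (X n k) (c * (2 ^+ n)^-1) (r ^+ n)
    (mulr_gt0 c0 (p0 n)) (exprn_gt0 n r0) (mX n k) (fun b => B_line _ _ K (p0 n)).
  move=> /le_trans; apply; rewrite lee_fin exprAC /a -exprMn.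
  rewrite le_eqVlt; apply/orP; left; apply/eqP; congr (_ ^+ K).
  have sqn : sg ^+ n = r ^+ n * Num.sqrt (2 ^+ n).
    rewrite /sg exprMn; congr (_ * _).
    by rewrite -[LHS]gtr0_norm ?exprn_gt0 ?sqrtr_gt0// -sqrtr_sqr exprAC sqr_sqrtr.
  rewrite sqn sqrtrM ?(ltW c0)// sqrtrV ?exprn_ge0//.
  by field; rewrite !gt_eqF ?sqrtr_gt0 ?exprn_gt0.
have E n := finite_union_bound (mA n) (AP n).
pose c1 : R := (2 * M%:R + 1) ^+ d.+1.
have c10 : 0 <= c1 by rewrite exprn_ge0// addr_ge0// mulr_ge0.
have bt : x * sg ^+ K <= 1 / 2.
  apply: le_trans (ler_wpM2l (ltW x0) KP) _.
  by rewrite le_eqVlt; apply/orP; left; apply/eqP; field; rewrite gt_eqF.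
have s0 : 0 <= sg ^+ K by rewrite exprn_ge0// ltW.
have := @borel_cantelli_geometric R _ _ P (fun n => [set w | exists k, A n k w])
  (c1 * a) (x * sg ^+ K).
move=> /(_ _ _ _ (fun n => (E n).1)) => bc.
apply: filterS (bc _ _ _ _).
- move=> w [n0 H]; exists n0 => n n0n k.
  have /existsNP[i /not_implyP[iK /negP]] : ~ A n k w.
    by move=> Ak; apply: (H n n0n); exists k.
  by rewrite -ltNge => lt; exists i.
- by rewrite mulr_ge0.
- by rewrite mulr_ge0// ltW.
- by apply: le_lt_trans bt _; lra.
- move=> n; apply: le_trans (E n).2 _.
  rewrite lee_fin.
  apply: (@le_trans _ _ ((c1 * x ^+ n) * (a * (sg ^+ K) ^+ n))).
    by rewrite ler_wpM2r ?card_grid// mulr_ge0// exprn_ge0.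
  by rewrite [(x * _) ^+ n]exprMn le_eqVlt; apply/orP; left; apply/eqP; ring.
Qed.

End no_small_increments.

(** * Pointwise exponents *)

Section euclidean_norm.
Context {R : realType} {d : nat}.
Implicit Types x t u : 'rV[R]_d.+1.

Lemma inner_ge0 x : 0 <= inner x x.
Proof. by apply: sumr_ge0 => i _; rewrite -expr2 sqr_ge0. Qed.

Lemma mx_norm_le_enorm x : `|x| <= enorm x.
Proof.
apply/mx_norm_le => [|i]; first exact: sqrtr_ge0.
rewrite -(@ler_pXn2r _ 2) ?nnegrE ?sqrtr_ge0// /enorm sqr_sqrtr ?inner_ge0//.
rewrite real_normK ?num_real// /inner (bigD1 i)//= -expr2 lerDl.
by apply: sumr_ge0 => j _; rewrite -expr2 sqr_ge0.
Qed.

Lemma enorm_le_mx_norm x : enorm x <= d.+1%:R * `|x|.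
Proof.
rewrite -(@ler_pXn2r _ 2) ?nnegrE ?sqrtr_ge0 ?mulr_ge0// /enorm sqr_sqrtr ?inner_ge0//.
apply: (@le_trans _ _ (\sum_(i < d.+1) `|x| ^+ 2)).
  apply: ler_sum => i _; rewrite -expr2 -(real_normK (num_real (x ord0 i))).
  by rewrite ler_pXn2r ?nnegrE// le_coord_mx_norm.
rewrite sumr_const card_ord -[leLHS]mulr_natl exprMn ler_wpM2r ?sqr_ge0//.
by rewrite expr2 ler_peMl// ler1n.
Qed.

End euclidean_norm.

Section locally_lipschitz.
Context {R : realType} {d : nat}.
Variable t0 : 'rV[R]_d.+1.
Implicit Types g h : 'rV[R]_d.+1 -> R.

(** Only increments from [t0] are controlled, on the unit ball around it; there g is bounded, whence
    the stability under products. *)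
Definition lipschitz_near g := exists2 L, 0 <= L &
  forall u, `|u - t0| <= 1 -> `|g u - g t0| <= L * `|u - t0|.

Lemma lipschitz_near_cst c : lipschitz_near (fun=> c).
Proof. by exists 0 => // u _; rewrite subrr normr0 mul0r. Qed.

Lemma lipschitz_near_coord i : lipschitz_near (fun u => u ord0 i).
Proof.
exists 1 => // u _; rewrite mul1r.
by have := le_coord_mx_norm (u - t0) i; rewrite !mxE.
Qed.

Lemma lipschitz_nearD g h : lipschitz_near g -> lipschitz_near h ->
  lipschitz_near (fun u => g u + h u).
Proof.
move=> [L L0 gL] [L' L'0 hL]; exists (L + L'); first exact: addr_ge0.
move=> u u1; rewrite opprD addrACA; apply: le_trans (ler_normD _ _) _.
by rewrite mulrDl lerD ?gL ?hL.
Qed.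

Lemma lipschitz_nearM g h : lipschitz_near g -> lipschitz_near h ->
  lipschitz_near (fun u => g u * h u).
Proof.
move=> [L L0 gL] [L' L'0 hL].
exists ((`|g t0| + L) * L' + `|h t0| * L).
  by rewrite addr_ge0 ?mulr_ge0 ?addr_ge0.
move=> u u1.
have -> : g u * h u - g t0 * h t0 = g u * (h u - h t0) + h t0 * (g u - g t0) by ring.
apply: le_trans (ler_normD _ _) _; rewrite !normrM [leRHS]mulrDl -!mulrA.
rewrite lerD ?ler_pM ?gL ?hL//.
rewrite -(subrK (g t0) (g u)) addrC; apply: le_trans (ler_normD _ _) _.
rewrite lerD2l; apply: le_trans (gL u u1) _.
by rewrite ler_piMr.
Qed.

Lemma lipschitz_near_mpoly (p : mpoly.mpoly d.+1 R) :
  lipschitz_near (fun u => mpoly.meval (fun i => u ord0 i) p).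
Proof.
have ext g h : (forall u, g u = h u) -> lipschitz_near g -> lipschitz_near h.
  by move=> gh; have -> : h = g by apply/funext => u; rewrite gh.
apply: (ext (fun u => \sum_(m <- mpoly.msupp p)
    mpoly.mcoeff m p * \prod_i u ord0 i ^+ mpoly.fun_of_multinom m i)).
  by move=> u; rewrite mpoly.mevalE.
elim: (mpoly.msupp p) => [|m s IH].
  by apply: (ext _ _ _ (lipschitz_near_cst 0)) => u; rewrite big_nil.
apply: (ext (fun u => mpoly.mcoeff m p * \prod_i u ord0 i ^+ mpoly.fun_of_multinom m i +
  \sum_(m <- s) mpoly.mcoeff m p * \prod_i u ord0 i ^+ mpoly.fun_of_multinom m i)).
  by move=> u; rewrite big_cons.
apply: lipschitz_nearD => //; apply: lipschitz_nearM; first exact: lipschitz_near_cst.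
have prodL (r : seq 'I_d.+1) :
    lipschitz_near (fun u => \prod_(i <- r) u ord0 i ^+ mpoly.fun_of_multinom m i).
  elim: r => [|i r IHr].
    by apply: (ext _ _ _ (lipschitz_near_cst 1)) => u; rewrite big_nil.
  apply: (ext (fun u => u ord0 i ^+ mpoly.fun_of_multinom m i *
     \prod_(i <- r) u ord0 i ^+ mpoly.fun_of_multinom m i)).
    by move=> u; rewrite big_cons.
  apply: lipschitz_nearM => //.
  elim: (mpoly.fun_of_multinom m i) => [|k IHk]; first exact: lipschitz_near_cst.
  apply: (ext (fun u => u ord0 i * u ord0 i ^+ k)) => [u|]; first by rewrite exprS.
  by apply: lipschitz_nearM => //; exact: lipschitz_near_coord.
exact: prodL.
Qed.

End locally_lipschitz.

Section pointwise_exponent.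
Context {R : realType} {d : nat}.
Variable f : 'rV[R]_d.+1 -> R.
Implicit Types t u : 'rV[R]_d.+1.

Lemma pointwise_holder_cst t0 (C eps g : R) : 0 < g -> 0 < eps ->
  (forall u, `|u - t0| < eps -> `|f u - f t0| <= C * `|u - t0| `^ g) ->
  pointwise_holder f t0 g.
Proof.
move=> g0 e0 H; exists (Num.max C 1); first by rewrite lt_max ltr01 orbT.
exists (mpoly.mpolyC d.+1 (f t0)).
  (* The measure of a constant is 0 or 1, with predecessor 0 in both cases. *)
  by rewrite mpoly.mmeasureC; case: (_ != _).
apply/nbhs_ballP; exists eps => //= u; rewrite -ball_normE /ball_ /= distrC => ue.
rewrite mpoly.mevalC; apply: le_trans (H u ue) _.
apply: (@le_trans _ _ (Num.max C 1 * `|u - t0| `^ g)).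
  by rewrite ler_wpM2r ?powR_ge0// le_max lexx.
rewrite ler_wpM2l ?le_max ?ler01 ?orbT//.
by rewrite ge0_ler_powR ?nnegrE ?sqrtr_ge0 ?mx_norm_le_enorm// ltW.
Qed.

Lemma pointwise_holder_increment t0 al : 1 / 2 < al -> pointwise_holder f t0 al ->
  exists2 g, 1 / 2 < g & exists C eps, [/\ 0 <= C, 0 < eps &
    forall u, `|u - t0| < eps -> `|f u - f t0| <= C * `|u - t0| `^ g].
Proof.
move=> al2 [C C0 [p _ /nbhs_ballP[e /= e0 H]]].
have al0 : 0 < al by lra.
have [L L0 pL] := lipschitz_near_mpoly t0 p.
set P := fun u => mpoly.meval (fun i => u ord0 i) p in pL.
(* The polynomial only contributes a Lipschitz term, so the exponent is capped
   at 1. *)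
pose g := Num.min al 1.
have g0 : 0 < g by rewrite lt_min al0 ltr01.
pose D := d.+1%:R : R.
have D0 : 0 <= D by exact: ler0n.
exists g; first by rewrite lt_min al2; lra.
(* At [t0] the bound reads C * 0^al = 0, so the polynomial takes the value of f there. *)
have ft0 : f t0 = P t0.
  have := H t0 (ballxx _ e0); rewrite subrr /enorm.
  have -> : inner (0 : 'rV[R]_d.+1) 0 = 0.
    by rewrite /inner big1// => i _; rewrite mxE mulr0.
  rewrite sqrtr0 powR0 ?gt_eqF// mulr0 normr_le0 subr_eq0 => /eqP; exact.
exists (C * D `^ al + L), (Num.min e 1); split.
- by rewrite addr_ge0// mulr_ge0 ?powR_ge0// ltW.
- by rewrite lt_min e0 ltr01.
move=> u; rewrite lt_min => /andP[ue u1].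
have := H u; rewrite -ball_normE /ball_ /= distrC => /(_ ue) Hu.
have := pL u (ltW u1) => pu.
have -> : f u - f t0 = (f u - P u) + (P u - P t0) by rewrite ft0; ring.
apply: le_trans (ler_normD _ _) _; rewrite mulrDl lerD//.
  apply: le_trans Hu _; rewrite -mulrA ler_wpM2l ?(ltW C0)//.
  apply: (@le_trans _ _ ((D * `|u - t0|) `^ al)).
    by rewrite ge0_ler_powR ?nnegrE ?sqrtr_ge0 ?mulr_ge0 ?enorm_le_mx_norm// ltW.
  rewrite powRM// ler_wpM2l ?powR_ge0//.
  have [->|un0] := eqVneq `|u - t0| 0; first by rewrite !powR0// gt_eqF.
  have u01 : 0 < `|u - t0| <= 1 by rewrite lt0r un0 normr_ge0 ltW.
  by apply: (ger_powR u01); rewrite ge_min lexx.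
apply: le_trans pu _; rewrite ler_wpM2l//.
have [->|un0] := eqVneq `|u - t0| 0; first by rewrite powR_ge0.
have u01 : 0 < `|u - t0| <= 1 by rewrite lt0r un0 normr_ge0 ltW.
by apply: (ger1_powR u01); rewrite ge_min lexx orbT.
Qed.

End pointwise_exponent.

Section dyadic_powers.
Context {R : realType}.

Lemma powR2N_exprn (g : R) n : (2 `^ (- g)) ^+ n = ((2 ^+ n)^-1) `^ g.
Proof.
by rewrite -powR_mulrn ?powR_ge0// -powRrM -powR_invn// -powRrM mulrC mulrN mulNr.
Qed.

(** The predecessor of the least m with 1 / (8 * 2^m) <= x is the required level; 16 is twice 8. *)
Lemma dyadic_scale (x : R) n0 : 0 < x -> x < 8^-1 / 2 ^+ n0 ->
  exists2 n, (n0 <= n)%N & x < 8^-1 / 2 ^+ n /\ (2 ^+ n)^-1 <= 16 * x.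
Proof.
move=> x0 xn0.
have half01 : 0 <= (2^-1 : R) < 1 by rewrite invr_ge0 ler0n/= invf_lt1// ltr1n.
have [N NP] := expr_le_eps half01 (mulr_gt0 (ltr0Sn R 7) x0).
have ex : exists m, 8^-1 / 2 ^+ m <= x.
  exists N; have := NP N (leqnn N); rewrite exprVn => h.
  by rewrite ler_pdivrMl.
have [m mP mmin] := ex_minnP ex.
have n0m : (n0 < m)%N.
  rewrite ltnNge; apply/negP => mn0.
  have : x < 8^-1 / 2 ^+ m.
    apply: lt_le_trans xn0 _; rewrite ler_pM2l ?invr_gt0//.
    by rewrite lef_pV2 ?posrE ?exprn_gt0// ler_weXn2l// ler1n.
  by rewrite ltNge mP.
case: m n0m mP mmin => // n n0n mP mmin.
exists n => //; split.
  by rewrite ltNge; apply/negP => /mmin; rewrite ltnn.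
move: mP; rewrite exprS invfM; set y := (2 ^+ n)^-1; lra.
Qed.

Lemma ltr_powR2 (x y : R) : x < y -> 2 `^ x < 2 `^ y.
Proof.
by move=> xy; rewrite /powR gt_eqF// ltr_expR ltr_pM2r// ln_gt0// ltr1n.
Qed.

Lemma powR2N_itv (g : R) : 0 < g -> 0 < 2 `^ (- g) < 1.
Proof.
move=> g0; rewrite powR_gt0//=; have : - g < 0 by rewrite oppr_lt0.
by move/ltr_powR2; rewrite powRr0.
Qed.

(** Translates the comparisons of 2 q^2 and 2 r^2 with 1 into the position of g relative to 1/2. *)
Lemma mul2_sqr_powR2N (g : R) : 2 * (2 `^ (- g)) ^+ 2 = 2 `^ (1 - 2 * g).
Proof.
rewrite -powR_mulrn ?powR_ge0// -powRrM powRD ?powRr1//.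
  by congr (_ * (_ `^ _)); ring.
by apply/implyP => _; rewrite gt_eqF.
Qed.

End dyadic_powers.

Section holder_exponent_half.
Context {R : realType} {d : nat}.
Variable f : 'rV[R]_d.+1 -> R.
Implicit Types t u : 'rV[R]_d.+1.

(** Countably many exponents tending to 1/2 on each side, so that a single null set can serve them
    all; the shift by 3 keeps [g_low] positive. *)
Let g_low (j : nat) : R := 1 / 2 - (j.+3%:R)^-1.
Let g_up (j : nat) : R := 1 / 2 + (j.+1%:R)^-1.

Hypothesis f_modulus : forall j M : nat, exists2 C, 0 <= C &
  exists n0, forall n, (n0 <= n)%N ->
  forall t u, `|t| < M%:R -> `|u| < M%:R -> `|t - u| < 8^-1 / 2 ^+ n ->
    `|f t - f u| <= C * (2 `^ (- g_low j)) ^+ n.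

Variable e : 'rV[R]_d.+1.
Hypothesis e1 : `|e| <= 1.
Hypothesis f_rough : forall j, exists K, forall M, exists n0,
  forall n, (n0 <= n)%N -> forall k, exists2 i, (i < K)%N &
    (2 `^ (- g_up j)) ^+ n < `|f (@grid_point R d M n k + (i.+1%:R * (2 ^+ n)^-1) *: e) -
                 f (grid_point k + (i%:R * (2 ^+ n)^-1) *: e)|.

Lemma g_low_gt0 j : 0 < g_low j.
Proof.
rewrite /g_low subr_gt0 div1r ltf_pV2 ?posrE ?ltr0n//.
by rewrite ltr_nat.
Qed.

Lemma exists_natr_gt (x : R) : exists M : nat, x < M%:R.
Proof. by exists (Num.truncn x).+1; exact: truncnS_gt. Qed.

Lemma pointwise_holder_low t j : pointwise_holder f t (g_low j).
Proof.
have [M tM] := exists_natr_gt (`|t| + 1).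
have [C C0 [n0 H]] := f_modulus j M.
pose eps : R := Num.min 1 (8^-1 / 2 ^+ n0).
have eps0 : 0 < eps by rewrite lt_min ltr01 divr_gt0 ?exprn_gt0// invr_gt0.
(* The 16 is the constant of [dyadic_scale], which picks the level n adapted to |u - t|. *)
apply: (@pointwise_holder_cst _ _ _ _ (C * 16 `^ g_low j) eps) => //.
  exact: g_low_gt0.
move=> u; rewrite lt_min => /andP[u1 un0].
have [/eqP|ut0] := eqVneq `|u - t| 0.
  rewrite normr_eq0 subr_eq0 => /eqP ->.
  by rewrite subrr normr0 !mulr_ge0 ?powR_ge0.
have utp : 0 < `|u - t| by rewrite lt0r ut0 normr_ge0.
have [n n0n [utn nut]] := dyadic_scale utp un0.
have uM : `|u| < M%:R.
  by rewrite -(subrK t u); apply: le_lt_trans (ler_normD _ _) _; lra.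
have tM' : `|t| < M%:R by lra.
apply: le_trans (H n n0n u t uM tM' utn) _.
rewrite -mulrA ler_wpM2l// powR2N_exprn -powRM//.
rewrite ge0_ler_powR ?nnegrE ?invr_ge0 ?exprn_ge0 ?mulr_ge0//.
exact/ltW/g_low_gt0.
Qed.

Lemma pointwise_holder_up t al : 1 / 2 < al -> ~ pointwise_holder f t al.
Proof.
move=> al2 /(pointwise_holder_increment al2)[g g2 [C [eps [C0 eps0 H]]]].
have [j jg] : exists j, g_up j < g.
  have [j jP] := exists_natr_gt ((g - 1 / 2)^-1).
  exists j; rewrite /g_up -ltrBrDl -[ltRHS]invrK ltf_pV2 ?posrE ?invr_gt0 ?subr_gt0//.
  by apply: lt_le_trans jP _; rewrite ler_nat.
have [K HK] := f_rough j.
have [M tM] := exists_natr_gt `|t|.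
have [n0 {HK}HK] := HK M.
pose r := 2 `^ (- g_up j).
have r0 : 0 < r by exact: powR_gt0.
have rg : 2 `^ (- g) < r by rewrite ltr_powR2// ltrN2.
pose z := 2 `^ (- g) / r.
have z01 : 0 <= z < 1 by rewrite divr_ge0 ?powR_ge0// ltr_pdivrMr// mul1r.
pose D := 2 * C * K.+1%:R `^ g.
have D0 : 0 <= D by rewrite mulr_ge0 ?mulr_ge0 ?powR_ge0.
(* [D] may vanish with C, hence the added 1 before inverting. *)
have D1 : 0 < D + 1 by rewrite ltr_wpDl.
have iD : 0 < (D + 1)^-1 by rewrite invr_gt0.
have [n1 Hn1] := expr_le_eps z01 iD.
have half01 : 0 <= (2^-1 : R) < 1 by rewrite invr_ge0 ler0n/= invf_lt1// ltr1n.
have eK : 0 < eps / (2 * K.+1%:R) by rewrite divr_gt0// mulr_gt0// ltr0n.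
have [n2 Hn2] := expr_le_eps half01 eK.
pose n := maxn n0 (maxn n1 n2).
have nn0 : (n0 <= n)%N by rewrite leq_maxl.
have nn1 : (n1 <= n)%N by rewrite (leq_trans (leq_maxl n1 n2)) ?leq_maxr.
have nn2 : (n2 <= n)%N by rewrite (leq_trans (leq_maxr n1 n2)) ?leq_maxr.
pose k := grid_index M n t.
have p0 : 0 < (2 ^+ n)^-1 :> R by rewrite invr_gt0 exprn_gt0.
(* One unit 2^-n accounts for rounding t to the grid and at most K for moving along e. *)
have close i : (i <= K)%N ->
    `|(grid_point k + (i%:R * (2 ^+ n)^-1) *: e) - t| <= K.+1%:R * (2 ^+ n)^-1.
  move=> iK; have h := grid_approx_le n (ltW tM).
  rewrite addrAC; apply: le_trans (ler_normD _ _) _.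
  rewrite distrC (natrD R 1 K) [leRHS]mulrDl mul1r lerD//.
  rewrite normrZ ger0_norm ?mulr_ge0 ?(ltW p0)//.
  apply: le_trans (ler_wpM2l _ e1) _; first by rewrite mulr_ge0 ?(ltW p0).
  by rewrite mulr1 ler_wpM2r ?(ltW p0)// ler_nat.
have small : K.+1%:R * (2 ^+ n)^-1 < eps.
  have := Hn2 n nn2; rewrite exprVn => h.
  have K0 : 0 < K.+1%:R :> R by rewrite ltr0n.
  apply: le_lt_trans (ler_wpM2l (ltW K0) h) _.
  have -> : K.+1%:R * (eps / (2 * K.+1%:R)) = eps / 2 by field; rewrite gt_eqF.
  lra.
have fclose i : (i <= K)%N ->
    `|f (grid_point k + (i%:R * (2 ^+ n)^-1) *: e) - f t| <=
    C * K.+1%:R `^ g * (2 `^ (- g)) ^+ n.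
  move=> iK; apply: le_trans (H _ (le_lt_trans (close i iK) small)) _.
  rewrite -mulrA ler_wpM2l// powR2N_exprn -powRM ?(ltW p0)//.
  rewrite ge0_ler_powR ?nnegrE ?mulr_ge0 ?(ltW p0) ?close//.
  lra.
have [i iK] := HK n nn0 k.
have h1 := fclose i.+1 iK; have h2 := fclose i (ltnW iK).
rewrite ltNge => /negP; apply.
set a := f _ in h1 *; set b := f _ in h2 *.
have -> : a - b = (a - f t) - (b - f t) by ring.
apply: le_trans (ler_normB _ _) _.
apply: le_trans (lerD h1 h2) _.
have zn : (2 `^ (- g)) ^+ n = z ^+ n * r ^+ n.
  by rewrite -exprMn /z divfK// gt_eqF.
rewrite zn -/r.
have rn : 0 < r ^+ n by rewrite exprn_gt0.
have {Hn1} := Hn1 n nn1.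
rewrite -(ler_pM2l D1) mulfV ?gt_eqF// => h.
have zn0 : 0 <= z ^+ n by rewrite exprn_ge0//; case/andP: z01.
have h3 : D * z ^+ n <= 1 by apply: le_trans h; rewrite ler_wpM2r// lerDl.
have -> : C * K.+1%:R `^ g * (z ^+ n * r ^+ n) + C * K.+1%:R `^ g * (z ^+ n * r ^+ n) =
   (D * z ^+ n) * r ^+ n by rewrite /D; ring.
by rewrite ler_piMl// ltW.
Qed.

Lemma holder_exponent_half t : holder_exponent f t = (1 / 2)%:E.
Proof.
apply/eqP; rewrite eq_le; apply/andP; split.
  apply: ge_ereal_sup => _ [al /= H <-]; rewrite lee_fin leNgt; apply/negP => al2.
  case: H => [al0|[_ /(pointwise_holder_up al2)]//].
  by move: al2; rewrite al0; lra.
apply/lee_addgt0Pr => eps eps0.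
have [j jP] := exists_natr_gt (eps^-1).
apply: (@le_trans _ _ ((g_low j)%:E + eps%:E)%E).
  have : (j.+3%:R)^-1 <= eps.
    rewrite -[leRHS]invrK lef_pV2 ?posrE ?ltr0n ?invr_gt0//.
    by apply: le_trans (ltW jP) _; rewrite ler_nat -addn3 leq_addr.
  by rewrite -EFinD lee_fin /g_low; set y := (_)^-1 => ye; lra.
rewrite leeD2r//; apply: ereal_sup_ubound; exists (g_low j) => //=.
by right; split; [exact: g_low_gt0|exact: pointwise_holder_low].
Qed.

End holder_exponent_half.

(** * Hausdorff dimension of open sets *)

Section hausdorff_null.
Local Open Scope ereal_scope.
Context {R : realType} {n : nat}.
Implicit Types (A B F : set 'rV[R]_n) (s : R).

Lemma ediam_ge0 A : A !=set0 -> 0 <= ediam A.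
Proof.
move=> [x Ax]; apply: (@le_trans _ _ (enorm (x - x))%:E).
  by rewrite lee_fin sqrtr_ge0.
by apply: ereal_sup_ubound; exists x => //; exists x.
Qed.

Lemma diam_pow_ge0 s A : 0 <= diam_pow s A.
Proof. by rewrite /diam_pow; case: ifP => // _; exact: poweR_ge0. Qed.

Lemma hausdorff_content_ge0 s delta A : 0 <= hausdorff_content s delta A.
Proof.
apply: le_ereal_inf_tmp => _ [F _ <-].
by apply: nneseries_ge0 => k _ _; exact: diam_pow_ge0.
Qed.

(** Nullity in terms of explicit covers, the only form used below. *)
Lemma hausdorff_measure_eq0 s A : hausdorff_measure s A = 0 <->
  forall delta eps : R, (0 < delta)%R -> (0 < eps)%R ->
  exists F : (set 'rV[R]_n)^nat, [/\ A `<=` \bigcup_k F k,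
    forall k, ediam (F k) <= delta%:E &
    \sum_(0 <= k <oo) diam_pow s (F k) <= eps%:E].
Proof.
split=> [A0 delta eps d0 e0|H].
  have : hausdorff_content s delta A < eps%:E.
    apply: (@le_lt_trans _ _ 0); last by rewrite lte_fin.
    by rewrite -A0; apply: ereal_sup_ubound; exists delta.
  move/ereal_inf_lt => [_ [F [AF Fd] <-] /ltW Fe].
  by exists F.
apply/eqP; rewrite eq_le; apply/andP; split.
  apply: ge_ereal_sup => _ [delta /= d0 <-].
  apply/lee_addgt0Pr => eps e0; rewrite add0e.
  have [F [AF Fd Fe]] := H _ _ d0 e0.
  by apply: le_trans Fe; apply: ereal_inf_lbound; exists F.
apply: (@le_trans _ _ (hausdorff_content s 1 A)); first exact: hausdorff_content_ge0.
by apply: ereal_sup_ubound; exists 1%R => //=.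
Qed.

Lemma hausdorff_null_subset s A B : A `<=` B ->
  hausdorff_measure s B = 0 -> hausdorff_measure s A = 0.
Proof.
move=> AB /hausdorff_measure_eq0 H; apply/hausdorff_measure_eq0 => delta eps d0 e0.
have [F [BF Fd Fe]] := H _ _ d0 e0.
by exists F; split => //; exact: subset_trans BF.
Qed.

Definition similitude (l : R) (b x : 'rV[R]_n) : 'rV[R]_n := (l *: x + b)%R.

Lemma ediam_similitude (l : R) b A : (0 < l)%R ->
  ediam (similitude l b @` A) <= l%:E * ediam A.
Proof.
move=> l0; apply: ge_ereal_sup => _ [_ [x Ax <-] [_ [y Ay <-] <-]].
have -> : (similitude l b x - similitude l b y = l *: (x - y))%R.
  by rewrite /similitude scalerBr opprD addrACA subrr addr0.
have -> : enorm (l *: (x - y)) = (l * enorm (x - y))%R.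
  rewrite /enorm; have -> : inner (l *: (x - y)) (l *: (x - y)) =
      (l ^+ 2 * inner (x - y) (x - y))%R.
    by rewrite /inner mulr_sumr; apply: eq_bigr => i _; rewrite !mxE; ring.
  by rewrite sqrtrM ?sqr_ge0// sqrtr_sqr gtr0_norm.
rewrite EFinM lee_pmul2l ?lte_fin//.
by apply: ereal_sup_ubound; exists x => //; exists y.
Qed.

Lemma diam_pow_similitude (l : R) b s A : (0 < l)%R -> (0 <= s)%R ->
  diam_pow s (similitude l b @` A) <= (l `^ s)%:E * diam_pow s A.
Proof.
move=> l0 s0; rewrite /diam_pow.
have [->|/set0P A0] := eqVneq A set0; first by rewrite image_set0 eqxx mule0.
rewrite ifF; last first.
  by apply/negbTE/set0P; case: A0 => x Ax; exists (similitude l b x); exists x.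
rewrite -poweR_EFin -poweRM ?lee_fin ?(ltW l0) ?ediam_ge0//.
apply: gt0_ler_poweR => //; last exact: ediam_similitude.
  rewrite in_itv/= leey andbT ediam_ge0//.
  by case: A0 => x Ax; exists (similitude l b x); exists x.
by rewrite in_itv/= leey andbT mule_ge0 ?lee_fin ?(ltW l0) ?ediam_ge0.
Qed.

Lemma hausdorff_null_similitude (l : R) b s A : (0 < l)%R -> (0 <= s)%R ->
  hausdorff_measure s A = 0 -> hausdorff_measure s (similitude l b @` A) = 0.
Proof.
move=> l0 s0 /hausdorff_measure_eq0 H; apply/hausdorff_measure_eq0 => delta eps d0 e0.
have ls : (0 < l `^ s)%R by exact: powR_gt0.
have [F [AF Fd Fe]] := H _ _ (divr_gt0 d0 l0) (divr_gt0 e0 ls).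
exists (fun k => similitude l b @` F k); split.
- by move=> _ [x /AF[k _ Fx] <-]; exists k => //; exists x.
- move=> k; apply: le_trans (ediam_similitude _ _ l0) _.
  apply: le_trans (lee_wpmul2l _ (Fd k)) _; first by rewrite lee_fin ltW.
  by rewrite -EFinM lee_fin mulrC divfK// gt_eqF.
- apply: (@le_trans _ _ (\sum_(0 <= k <oo) ((l `^ s)%:E * diam_pow s (F k)))).
    apply: lee_nneseries => [k _ _|k _]; first exact: diam_pow_ge0.
    exact: diam_pow_similitude.
  rewrite nneseriesZl; last by move=> k _; exact: diam_pow_ge0.
  apply: le_trans (lee_wpmul2l _ Fe) _; first by rewrite lee_fin ltW.
  by rewrite -EFinM lee_fin mulrC divfK// gt_eqF.
Qed.

(** The j-th set receives a cover of cost eps / 2^(j+1), and the covers are merged into one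
    sequence. *)
Lemma hausdorff_null_bigcup s (A : (set 'rV[R]_n)^nat) :
  (forall j, hausdorff_measure s (A j) = 0) ->
  hausdorff_measure s (\bigcup_j A j) = 0.
Proof.
move=> A0; apply/hausdorff_measure_eq0 => delta eps d0 e0.
have [F FP] : {F : nat -> (set 'rV[R]_n)^nat & forall j,
    [/\ A j `<=` \bigcup_k F j k, forall k, ediam (F j k) <= delta%:E &
    \sum_(0 <= k <oo) diam_pow s (F j k) <= (eps / (2 ^ j.+1)%:R)%:E]}.
  apply: (@choice _ _ (fun j (G : (set 'rV[R]_n)^nat) =>
    [/\ A j `<=` \bigcup_k G k, forall k, ediam (G k) <= delta%:E &
    \sum_(0 <= k <oo) diam_pow s (G k) <= (eps / (2 ^ j.+1)%:R)%:E])) => j.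
  move/hausdorff_measure_eq0 : (A0 j); apply => //.
  by rewrite divr_gt0// ltr0n expn_gt0.
(* A bijection from nat to nat * nat enumerates the merged cover; sums over arbitrary index sets
   justify the rearrangement of nonnegative terms. *)
have /card_esym/ppcard_eqP[f] := card_nat2.
exists (fun k => F (f k).1 (f k).2); split.
- move=> x [j _ Ax]; have [Aj _ _] := FP j; have [k _ Fx] := Aj x Ax.
  by exists (f^-1%FUN (j, k)) => //; rewrite invK ?inE.
- by move=> k; have [_ + _] := FP (f k).1; exact.
have ge0 (jk : nat * nat) : 0 <= diam_pow s (F jk.1 jk.2) by exact: diam_pow_ge0.
apply: le_trans (epsilon_trick0 xpredT (ltW e0)).
apply: (@le_trans _ _ (\sum_(0 <= j <oo) \sum_(0 <= k <oo) diam_pow s (F j k))); last first.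
  apply: lee_nneseries => [j _ _|j _].
    by apply: nneseries_ge0 => k _ _; exact: diam_pow_ge0.
  by have [] := FP j.
rewrite nneseries_esumT; last by move=> k; exact: (ge0 (f k)).
rewrite -(@reindex_esum R _ _ setT setT f
  (fun jk => diam_pow s (F jk.1 jk.2))); last exact: bij.
have eqe : \sum_(0 <= j <oo) \sum_(0 <= k <oo) diam_pow s (F j k) =
    \sum_(0 <= j <oo) \esum_(k in [set: nat]) diam_pow s (F j k).
  by apply: eq_eseriesr => j _; apply: nneseries_esumT => k; exact: (ge0 (j, k)).
rewrite eqe.
rewrite [leRHS]nneseries_esumT; last first.
  by move=> j; apply: esum_ge0 => k _; exact: (ge0 (j, k)).
rewrite esum_esum; last by move=> j k _ _; exact: (ge0 (j, k)).
by rewrite (_ : setT `*`` _ = setT)//; apply/seteqP; split.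
Qed.

Lemma hausdorff_dim_eq A B : A !=set0 -> B !=set0 ->
  (forall s, (0 <= s)%R -> hausdorff_measure s A = 0 <-> hausdorff_measure s B = 0) ->
  hausdorff_dim A = hausdorff_dim B.
Proof.
move=> /set0P/negbTE A0 /set0P/negbTE B0 H; rewrite /hausdorff_dim A0 B0.
congr ereal_inf; congr (_ @` _).
by apply/seteqP; split => s [s0 /(H s s0) ?]; split.
Qed.

End hausdorff_null.

Section hausdorff_dim_open.
Context {R : realType} {d : nat}.
Implicit Types W : set 'rV[R]_d.+1.

(** W contains a ball, whose similar copies cover the balls of radius j + 1 around 0 and hence the
    whole space; so every set is null as soon as W is. *)
Lemma hausdorff_null_open (s : R) W W' : 0 <= s -> open W -> W !=set0 ->
  hausdorff_measure s W = 0%E -> hausdorff_measure s W' = 0%E.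
Proof.
move=> s0 oW [x Wx] W0.
have /nbhs_ballP[r /= r0 xrW] : nbhs x W by exact: open_nbhs_nbhs.
have B0 := hausdorff_null_subset xrW W0.
apply: (@hausdorff_null_subset _ _ _ _ (\bigcup_j (ball (0 : 'rV[R]_d.+1) j.+1%:R))).
  move=> y _; exists (Num.truncn `|y|) => //.
  by rewrite -ball_normE /ball_ /= sub0r normrN truncnS_gt.
apply: hausdorff_null_bigcup => j.
have l0 : 0 < j.+1%:R / r by rewrite divr_gt0.
apply: hausdorff_null_subset (hausdorff_null_similitude (- ((j.+1%:R / r) *: x)) l0 s0 B0).
move=> y; rewrite -ball_normE /ball_ /= sub0r normrN => yj.
exists ((r / j.+1%:R) *: y + x); last first.
  rewrite /similitude scalerDr addrK scalerA mulrA divfK ?gt_eqF//.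
  by rewrite mulfV ?scale1r// pnatr_eq0.
rewrite opprD addrCA subrr addr0 normrN normrZ.
by rewrite ger0_norm ?divr_ge0 ?(ltW r0)// mulrAC ltr_pdivrMr ?ltr0n// ltr_pM2l.
Qed.

Lemma hausdorff_dim_open W W' : open W -> W !=set0 -> open W' -> W' !=set0 ->
  hausdorff_dim W = hausdorff_dim W'.
Proof.
move=> oW W0 oW' W'0; apply: hausdorff_dim_eq => // s s0.
by split; apply: hausdorff_null_open.
Qed.

Lemma hausdorff_dim_ge0 W : W !=set0 -> (0 <= hausdorff_dim W)%E.
Proof.
move=> /set0P/negbTE W0; rewrite /hausdorff_dim W0.
by apply: le_ereal_inf_tmp => _ [s [s0 _] <-]; rewrite lee_fin.
Qed.

End hausdorff_dim_open.

(** * The almost sure exponent and the spectrum of the field *)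

Theorem theorem2 (R : realType) (d : nat)
    (mu : {finite_measure set (sphere R d) -> \bar R})
    (mu_sym : symmetric_measure mu) (mu_neq0 : mu [set: sphere R d] <> 0%E)
    (dO : measure_display) (Omega : measurableType dO)
    (P : probability Omega R)
    (G : set (R * sphere R d) -> {RV P >-> R})
    (G_noise : white_noise mu G)
    (B : 'rV[R]_d.+1 -> {RV P >-> R})
    (B_mod : modification (fun t => G (Vset t)) B)
    (B_sep : separable_field B) :
  [/\ homogeneous B, mono_holder B &
      {ae P, forall w, forall t : 'rV[R]_d.+1,
        holder_exponent (fun u => B u w) t = (1 / 2)%:E}].
Proof.
have holder : {ae P, forall w, forall t : 'rV[R]_d.+1,
    holder_exponent (fun u => B u w) t = (1 / 2)%:E}.
  pose C0 := d.+1%:R * fine (mu setT).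
  have C00 : 0 <= C0 by rewrite mulr_ge0// fine_ge0.
  have B_inc t u : exists2 v, v <= C0 * `|t - u| &
      centered_gaussian P (fun w => B t w - B u w) v.
    exists (increment_variance mu (t - u)); first exact: increment_variance_le.
    exact: (field_increment_gaussian mu_sym G_noise B_mod).
  have [i0 c0] := increment_variance_delta_gt0 mu_neq0.
  pose e : 'rV[R]_d.+1 := delta_mx ord0 i0.
  have e1 : `|e| <= 1.
    apply/mx_norm_le => // j; rewrite mxE eqxx /=.
    by case: (j == i0); rewrite ?normr1 ?normr0.
  (* The same sequences as [g_low] and [g_up], to which they are convertible. *)
  pose gl (j : nat) : R := 1 / 2 - (j.+3%:R)^-1.
  pose gu (j : nat) : R := 1 / 2 + (j.+1%:R)^-1.
  have modulus : {ae P, forall w, forall j M : nat, exists n0, forall n, (n0 <= n)%N ->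
      forall t u : 'rV[R]_d.+1, `|t| < M%:R -> `|u| < M%:R -> `|t - u| < 8^-1 / 2 ^+ n ->
      `|B t w - B u w| <= 2 * (3 + 2 / (1 - 2 `^ (- gl j))) * (2 `^ (- gl j)) ^+ n}.
    apply: ae_foralln => j; apply: ae_foralln => M.
    apply: (kolmogorov_chentsov C00 B_inc B_sep).
      by apply: powR2N_itv; exact: g_low_gt0.
    rewrite mul2_sqr_powR2N.
    have : 0 < 1 - 2 * gl j.
      have : 0 < (j.+3%:R : R)^-1 by rewrite invr_gt0.
      by rewrite /gl; set y := (_)^-1 => y0; lra.
    by move/ltr_powR2; rewrite powRr0.
  (* K is deterministic and common to all M, so the almost sure events over M can be intersected
     before w is fixed. *)
  have rough_K j : exists K : nat, forall M : nat, {ae P, forall w, exists n0,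
      forall n, (n0 <= n)%N -> forall k, exists2 i, (i < K)%N &
      (2 `^ (- gu j)) ^+ n < `|B (@grid_point R d M n k + (i.+1%:R * (2 ^+ n)^-1) *: e) w -
                 B (grid_point k + (i%:R * (2 ^+ n)^-1) *: e) w|}.
    apply: (no_small_increments c0).
    - by move=> p h b K h0; exact: (field_line_cos mu_sym G_noise B_mod).
    - exact: powR_gt0.
    - rewrite mul2_sqr_powR2N.
      have : 1 - 2 * gu j < 0.
        have : 0 < (j.+1%:R : R)^-1 by rewrite invr_gt0.
        by rewrite /gu; set y := (_)^-1 => y0; lra.
      by move/ltr_powR2; rewrite powRr0.
  have rough : {ae P, forall w, forall j, exists K, forall M, exists n0,
      forall n, (n0 <= n)%N -> forall k, exists2 i, (i < K)%N &
      (2 `^ (- gu j)) ^+ n < `|B (@grid_point R d M n k + (i.+1%:R * (2 ^+ n)^-1) *: e) w -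
                 B (grid_point k + (i%:R * (2 ^+ n)^-1) *: e) w|}.
    apply: ae_foralln => j; have [K HK] := rough_K j.
    have := ae_foralln HK.
    by apply: filterS => w Hw; exists K.
  apply: filterS2 modulus rough => w mod_w rough_w t.
  apply: (@holder_exponent_half R d (fun u => B u w) _ e e1 rough_w) => j M.
  exists (2 * (3 + 2 / (1 - 2 `^ (- gl j)))) => //.
  have gl0 : 0 < gl j by exact: g_low_gt0.
  have /andP[_ q1] := powR2N_itv gl0.
  by rewrite mulr_ge0// addr_ge0// divr_ge0// subr_ge0 ltW.
(* Almost surely the level set of 1/2 is the whole space, whose trace on W is W, and all other level
   sets are empty. *)
pose D (h : \bar R) : \bar R :=
  if h == (1 / 2)%:E then hausdorff_dim [set: 'rV[R]_d.+1] else -oo%E.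
have TN0 : [set: 'rV[R]_d.+1] !=set0 by exists 0.
have spec : has_spectrum B D.
  apply: filterS holder => w Hw h W h0 oW W0.
  rewrite /local_spectrum /D; case: ifPn => [/eqP ->|h12].
    rewrite (_ : iso_holder _ _ = setT) ?setTI.
      by apply: hausdorff_dim_open => //; exact: openT.
    by apply/seteqP; split => // t _; exact: Hw.
  rewrite (_ : iso_holder _ _ = set0) ?set0I /hausdorff_dim ?eqxx//.
  apply/seteqP; split => // t; rewrite /iso_holder/= Hw => h12'.
  by move/eqP : h12; rewrite h12'.
split => //; first by exists D.
exists D; split => //; exists (1 / 2)%:E.
apply/seteqP; split => h /=.
  rewrite /spectrum_support /D /= => -[_]; case: ifPn => [/eqP//|_].
  by rewrite leeNy_eq.
move=> ->; split; first by rewrite lee_fin.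
by rewrite /D eqxx; exact: hausdorff_dim_ge0.
Qed.
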